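(* Fix a configuration $c\in\mathcal C$ and two distinct programs $f,g\in\mathcal F$. For the single-block design $\beta(n)$ (with $n$ a positive multiple of $\mathrm F=|\mathcal F|$), the variance of the estimator $\hat\Delta^c(f,g)$ satisfies $$\operatorname{Var}[\hat\Delta^c(f,g)] = O(n^{-1})\qquad (n\to\infty).$$
   Context: Measurement model. $\mathcal F$ is a finite set of programs, $\mathrm F=|\mathcal F|\ge 2$; $\mathcal C$ is a set of configurations. For a fixed configuration $c$, an experiment with $n$ runs generates programs $F_1,\dots,F_n\in\mathcal F$, unobserved uncontrolled states $U_1,U_2,\dots\in\mathcal U$, and real measurements $T_1,\dots,T_n$ sequentially: the initial state $U_1$ is supplied by the environment (arbitrary distribution); at run $i$ the design chooses $F_i$ (using only previously observed variables), then $T_i$ is drawn from a fixed unknown conditional distribution of $T$ given $(U=U_i,F=F_i,c)$, then $U_{i+1}$ is drawn from a fixed unknown conditional distribution given $(T=T_i,U=U_i,F=F_i,c)$. These two conditional distributions depend neither on $i$ nor on the design. Delta design. A design is a delta design if the following hold. (1) Additive global effect: $T_i=\mathcal T_i+\mathcal E_i$, where, conditionally on $F_{\le i},U_{\le i},T_{<i}$, the ''true run time'' $\mathcal T_i$ and the ''environmental noise'' $\mathcal E_i$ are independent, $\mathcal T_i$ has a fixed distribution depending only on $(F_i,c)$, and $\mathcal E_i$ has a fixed distribution depending only on $(U_i,c)$. (In the multiplicative version of the assumption, $T,\mathcal T,\mathcal E$ stand for the logarithms of the positive quantities, so the same additive formulation applies.) (2) $T$ is essentially bounded (hence so are $\mathcal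 T$ and $\mathcal E$, given $c$). (3) $F_i$ is conditionally independent of the earlier measurements and of the configuration given $F_{<i}$ (together with the sequential structure above, $F_i$ depends on the past only through $F_{<i}$), and each $F_i$ has full support $\mathcal F$. (4) The loss estimator is $\hat L(f,c)=\bar T_f=\frac1{N_f}\sum_{i=1}^n \mathbb 1_{F_i=f}T_i$, where $N_f=\sum_{i=1}^n\mathbb 1_{F_i=f}$. The estimated per-configuration delta is $\hat\Delta^c(f,g)=\hat L(f,c)-\hat L(g,c)$. Single-block design $\beta(n)$. For $n$ divisible by $\mathrm F$, $\beta(n)$ is the delta design in which $(F_1,\dots,F_n)$ are sampled without replacement from the multiset containing exactly $n/\mathrm F$ copies of each program. *)

(* Defs.v *)
From HB Require Import structures.
From mathcomp Require Import all_boot all_order all_algebra.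
From mathcomp Require Import all_classical all_reals all_analysis.
From mathcomp Require Import measurable_realfun.
Import Order.TTheory GRing.Theory Num.Theory.
Import numFieldNormedType.Exports.

Set Implicit Arguments.
Unset Strict Implicit.
Unset Printing Implicit Defensive.

Local Open Scope classical_set_scope.
Local Open Scope ring_scope.

(* MathComp-Analysis has no conditional expectation: conditional probabilities,
   conditional laws and conditional independence with respect to a
   sub-sigma-algebra G, given as a set of events, are defined here. *)
Section conditioning.
Context {R : realType} {d : measure_display} {Omega : measurableType d}.
Variable P : probability Omega R.
Implicit Types (G : set (set Omega)) (A : set Omega).

(* p is a version of P(A | G). *)
Definition is_cond_prob G A (p : Omega -> \bar R) : Prop :=
  [/\ forall B : set (\bar R), measurable B -> G (p @^-1` B),
      P.-integrable setT p &
      forall D, G D -> (\int[P]_(w in D) p w = P (A `&` D))%E].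

(* k is a regular version of the conditional law of X given G. *)
Definition is_cond_law {dE : measure_display} {E : measurableType dE}
    G (X : Omega -> E) (k : Omega -> set E -> \bar R) : Prop :=
  forall B : set E, measurable B ->
    is_cond_prob G (X @^-1` B) (fun w => k w B).

(* P(A1 A2 | G) = P(A1 | G) P(A2 | G) almost surely, for A1 in G1, A2 in G2.
   Versions always exist and are almost surely unique, so that asking for some
   versions or for all of them is the same. *)
Definition cond_indep G (G1 G2 : set (set Omega)) : Prop :=
  forall A1 A2, G1 A1 -> G2 A2 -> exists p1 p2 : Omega -> \bar R,
    [/\ is_cond_prob G A1 p1, is_cond_prob G A2 p2 &
        is_cond_prob G (A1 `&` A2) (fun w => p1 w * p2 w)%E].

End conditioning.

(* Events on X 0, ..., X (i - 1); ES is the sigma-algebra of the target.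
   These events generate the sigma-algebra of X_{<i}. *)
Definition events_before {Omega E : Type} (ES : set (set E))
    (X : nat -> Omega -> E) (i : nat) : set (set Omega) :=
  \bigcup_(j in `I_i) preimage_set_system setT (X j) ES.

(* The two conditional distributions of the system, shared by all runs and all
   experiments; the finite set of programs is discrete, so dependence on the
   program needs no measurability. *)
Record system (R : realType) (F : finType) (dU : measure_display)
    (U : measurableType dU) (C : Type) := System {
  run_kernel : C -> F -> R.-pker U ~> R;
  env_kernel : C -> F -> R.-pker (R * U)%type ~> U }.

(* The laws of the true run time (depending on the program) and of the
   environmental noise (depending on the state). *)
Record additive_laws (R : realType) (F : finType) (dU : measure_display)
    (U : measurableType dU) (C : Type) := AdditiveLaws {
  true_law : C -> F -> probability R R;
  noise_law : C -> R.-pker U ~> R }.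

(* The configuration is a parameter of the law, not a random variable. Runs are
   numbered from 0: in an experiment with n runs only prog i and time i with
   i < n, and state i with i <= n, are constrained. *)
Record experiment (R : realType) (F : finType) (dU : measure_display)
    (U : measurableType dU) (C : Type) := Experiment {
  exp_display : measure_display;
  sample : measurableType exp_display;
  law : C -> probability sample R;
  prog : nat -> sample -> F;
  state : nat -> sample -> U;
  time : nat -> sample -> R }.

Arguments run_kernel {R F dU U C}.
Arguments env_kernel {R F dU U C}.
Arguments true_law {R F dU U C}.
Arguments noise_law {R F dU U C}.
Arguments law {R F dU U C}.
Arguments prog {R F dU U C}.
Arguments state {R F dU U C}.
Arguments time {R F dU U C}.

Section designs.
Context {R : realType} {F : finType} {dU : measure_display}
  {U : measurableType dU} {C : Type}.
Implicit Types (e : experiment R F U C) (n i : nat) (f g : F).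
Local Unset Implicit Arguments.

Definition prog_before e i := events_before (@setT (set F)) (prog e) i.
Definition state_before e i := events_before measurable (state e) i.
Definition time_before e i := events_before measurable (time e) i.

Definition prog_at e i := preimage_set_system setT (prog e i) setT.

(* The law of the initial state is unconstrained. *)
Record sequential (s : system R F U C) n e : Prop := Sequential {
  seq_prog_measurable : forall i f, (i < n)%N ->
    measurable (prog e i @^-1` [set f]);
  seq_state_measurable : forall i, (i <= n)%N ->
    measurable_fun setT (state e i);
  seq_time_measurable : forall i, (i < n)%N ->
    measurable_fun setT (time e i);
  seq_design : forall c i, (i < n)%N ->
    cond_indep (law e c) <<s prog_before e i `|` time_before e i >>
      (prog_at e i) <<s state_before e i.+1 >>;
  seq_run : forall c i, (i < n)%N ->
    is_cond_law (law e c)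
      <<s prog_before e i.+1 `|` state_before e i.+1 `|` time_before e i >>
      (time e i) (fun w => run_kernel s c (prog e i w) (state e i w));
  seq_env : forall c i, (i < n)%N ->
    is_cond_law (law e c)
      <<s prog_before e i.+1 `|` state_before e i.+1 `|` time_before e i.+1 >>
      (state e i.+1)
      (fun w => env_kernel s c (prog e i w) (time e i w, state e i w)) }.

(* Conditional independence of prog i from (time_{<i}, c) given prog_{<i} is
   stated as independence from time_{<i} for every c, together with the
   existence of a version of the conditional law of prog i given prog_{<i} that
   serves all configurations. Being part of the fixed system, the essential
   bound M does not depend on the experiment. *)
Record delta_design (s : system R F U C) (a : additive_laws R F U C) (M : R) n e
    : Prop := DeltaDesign {
  delta_sequential : sequential s n e;
  delta_additive : forall c i, (i < n)%N ->
    exists X Y : sample e -> R,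
    let G :=
      <<s prog_before e i.+1 `|` state_before e i.+1 `|` time_before e i >> in
    [/\ measurable_fun setT X /\ measurable_fun setT Y,
        forall w, time e i w = X w + Y w,
        is_cond_law (law e c) G X (fun w => true_law a c (prog e i w)),
        is_cond_law (law e c) G Y (fun w => noise_law a c (state e i w)) &
        cond_indep (law e c) G (preimage_set_system setT X measurable)
          (preimage_set_system setT Y measurable)];
  delta_bounded : forall c i, (i < n)%N ->
    {ae law e c, forall w, `|time e i w| <= M};
  delta_indep_time : forall c i, (i < n)%N ->
    cond_indep (law e c) <<s prog_before e i >> (prog_at e i)
      <<s time_before e i >>;
  delta_indep_config : forall i f, (i < n)%N ->
    exists p : sample e -> \bar R, forall c,
      is_cond_prob (law e c) <<s prog_before e i >>
        (prog e i @^-1` [set f]) p;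
  delta_full_support : forall c i f, (i < n)%N ->
    (0 < law e c (prog e i @^-1` [set f]))%E }.

(* For i = n this is N_f. *)
Definition count_before e i f (w : sample e) : nat :=
  (\sum_(j < i) (prog e j w == f))%N.

Definition loss_hat e n f (w : sample e) : R :=
  (count_before e n f w)%:R^-1 * \sum_(i < n) (prog e i w == f)%:R * time e i w.

Definition delta_hat e n f g (w : sample e) : R :=
  loss_hat e n f w - loss_hat e n g w.

(* Sampling without replacement: given the earlier programs, each of the n - i
   items left in the multiset is equally likely to be drawn at run i. *)
Record single_block (s : system R F U C) (a : additive_laws R F U C) (M : R) n e
    : Prop := SingleBlock {
  block_delta : delta_design s a M n e;
  block_draw : forall c i f, (i < n)%N ->
    is_cond_prob (law e c) <<s prog_before e i >>
      (prog e i @^-1` [set f])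
      (fun w => (((n %/ #|F|)%:R - (count_before e i f w)%:R) / (n - i)%:R)%:E) }.

End designs.

(* Main.v *)
Require Import Defs.
From mathcomp Require Import all_boot all_order all_algebra.
From mathcomp Require Import all_classical all_reals all_analysis.
From mathcomp Require Import measurable_realfun.
From mathcomp Require Import ring lra.
Import Order.TTheory GRing.Theory Num.Theory.
Import numFieldNormedType.Exports.

(* Up to a null set, [n / #|F| * (delta_hat - E)], with E the difference of the
   mean true run times of f and g, is a sum of three terms. With
   h_i = 1[F_i = f] - 1[F_i = g] and S_i = sum_(j < i) h_j they are
     sum_i h_i (T_i - mu(F_i) - nu(U_i)),
     sum_i (h_i + S_i / (n - i)) nu(U_i),
     - sum_i S_i / (n - i) nu(U_i).
   The first two are martingales with bounded second moments of the increments: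
   sampling without replacement makes - S_i / (n - i) the conditional mean of
   h_i given the whole past, the state U_i included. The same fact gives
   E S_i^2 <= n - i, so by Minkowski the third sum has L2 norm at most
   L sum_i (n - i)^(-1/2) <= 2 L sqrt n. All three are O(sqrt n) in L2. *)

Set Implicit Arguments.
Unset Strict Implicit.
Unset Printing Implicit Defensive.

Local Open Scope classical_set_scope.
Local Open Scope ring_scope.

(** * Bounded measurable functions *)

(** States may depend on all earlier programs, so nu(U_i) cannot be averaged out apart from the
    draws: each draw has to be centred with U_i already fixed, and the third sum is the price of
    that centring. Conditional expectations never occur as objects: that Z has conditional mean 0
    given G is expressed as E(W Z) = 0 for every bounded G-measurable W. For the draws this asks
    that a conditional probability given the earlier programs survive the addition of times and
    states, which two successive conditional independences provide. Boundedness is assumed of the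
    measurement only, not of its two summands. If [-K, K] carries at least half the mass of each law
    of a true run time, the noise is almost surely at most K + |M| and hence the true run time at
    most L = K + 2 |M|. K comes from these laws alone, so L is the same for all n. The squared L2
    norms of the three sums are at most 9 n L^2, n L^2 and 4 n L^2, and (x + y + z)^2 <= 3 (x^2 +
    y^2 + z^2) yields the constant 42. *)

Definition bmeas {R : realType} {d : measure_display} {T : measurableType d}
    (W : T -> R) : Prop :=
  measurable_fun setT W /\ exists b : R, forall w, `|W w| <= b.

Section bounded_measurable.
Context {R : realType} {d : measure_display} {T : measurableType d}.
Implicit Types (V W : T -> R) (k : R).

Lemma bmeas_cst k : bmeas (fun _ : T => k).
Proof. by split; [exact: measurable_cst|exists `|k|]. Qed.

Lemma bmeasD V W : bmeas V -> bmeas W -> bmeas (fun w => V w + W w).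
Proof.
move=> [mV [v Vv]] [mW [b Wb]]; split; first exact: measurable_funD.
by exists (v + b) => w; rewrite (le_trans (ler_normD _ _))// lerD.
Qed.

Lemma bmeasM V W : bmeas V -> bmeas W -> bmeas (fun w => V w * W w).
Proof.
move=> [mV [v Vv]] [mW [b Wb]]; split; first exact: measurable_funM.
by exists (v * b) => w; rewrite normrM ler_pM.
Qed.

Lemma bmeas_sqr W : bmeas W -> bmeas (fun w => W w ^+ 2).
Proof. by move=> bW; under eq_fun do rewrite expr2; exact: bmeasM. Qed.

Lemma bmeasZ k W : bmeas W -> bmeas (fun w => k * W w).
Proof. by move=> bW; apply: bmeasM => //; exact: bmeas_cst. Qed.

Lemma bmeasB V W : bmeas V -> bmeas W -> bmeas (fun w => V w - W w).
Proof.
move=> bV /(bmeasZ (-1)) bW; have := bmeasD bV bW.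
by under eq_fun do rewrite mulN1r.
Qed.

Lemma bmeas_sum (n : nat) (V : nat -> T -> R) :
  (forall i, (i < n)%N -> bmeas (V i)) -> bmeas (fun w => \sum_(i < n) V i w).
Proof.
elim: n => [_|n IH bV].
  by under eq_fun do rewrite big_ord0; exact: bmeas_cst.
under eq_fun do rewrite big_ord_recr/=.
by apply: bmeasD; [apply: IH => i ?; exact/bV/ltnW|exact: bV].
Qed.

Lemma bmeas_indic (A : set T) : measurable A -> bmeas (\1_A : T -> R).
Proof.
move=> mA; split; first exact: measurable_indic.
by exists 1 => w; rewrite indicE; case: (_ \in _); rewrite ?normr1 ?normr0.
Qed.

(** Layer-cake approximation: after shifting by the bound [b] and dividing by [eps], a nonnegative
    number is within 1 of the number of positive integers below it, counted up to a cutoff. Uniform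
    closeness allows the same approximation under every measure. *)
Lemma bmeas_simple_approx (W : T -> R) (eps : R) : bmeas W -> 0 < eps ->
  exists (n : nat) (c : nat -> R) (B : nat -> set T),
    (forall j, measurable (B j)) /\
    forall w, `|W w - \sum_(j < n) c j * \1_(B j) w| <= eps.
Proof.
move=> [mW [b Wb]] e0.
(* The sum is the integer part of [t] cut off at [n]; the induction on [n] removes one step and
   lowers [t] by 1. *)
have staircase (n : nat) (t : R) : 0 <= t <= n.+1%:R ->
    `|t - \sum_(j < n) (j.+1%:R <= t)%R%:R| <= 1.
  elim: n t => [|n IH] t /andP[t0 tn].
    by rewrite big_ord0 subr0 ger0_norm.
  have [t1|t1] := leP 1 t.
    rewrite big_ord_recl/= t1 opprD addrA.
    rewrite (eq_bigr (fun j : 'I_n => (j.+1%:R <= t - 1)%R%:R)).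
      by apply: IH; rewrite subr_ge0 t1/= lerBlDr natr1.
    by move=> j _; rewrite /bump/= add1n lerBrDr natr1.
  rewrite big1 ?subr0 ?ger0_norm//; first exact: ltW.
  move=> j _.
  by rewrite leNgt (lt_le_trans t1)//= ler1n.
pose n := Num.truncn (2 * b / eps).
(* The extra index [n] carries [- b] on the whole space and undoes the shift. *)
exists n.+1, (fun j => if (j == n)%N then - b else eps).
exists (fun j => if (j == n)%N then setT else [set w | j.+1%:R <= (W w + b) /
    eps]).
split=> [j|w].
  case: ifP => // _; rewrite -[X in measurable X]setTI.
  apply: (@measurable_fun_ler _ _ _ setT (fun=> j.+1%:R) (fun w => (W w + b) /
      eps)) => //.
  by apply: measurable_funM => //; exact: measurable_funD.
rewrite big_ord_recr/= eqxx indicT mulr1.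
rewrite (eq_bigr (fun j : 'I_n => eps * (j.+1%:R <= (W w + b) / eps)%R%:R));
    last first.
  move=> j _; rewrite (ltn_eqF (ltn_ord j)) indicE; congr (_ * _%:R).
  by apply: congr1; apply/idP/idP; rewrite inE.
rewrite -mulr_sumr.
set t := (W w + b) / eps.
have := Wb w; rewrite ler_norml => /andP[bW Wb'].
have /staircase : 0 <= t <= n.+1%:R.
  rewrite divr_ge0 ?(ltW e0)//=; last lra.
  by rewrite ltW// (le_lt_trans _ (truncnS_gt _))// ler_pM2r ?invr_gt0//; lra.
have -> : W w = eps * t - b by rewrite /t mulrCA divff ?gt_eqF// mulr1 addrK.
set s := \sum_(i < _) _ => st.
rewrite (_ : _ - b - (_ + - b) = eps * (t - s)); last by ring.
by rewrite normrM gtr0_norm// ler_piMr// ltW.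
Qed.

End bounded_measurable.

Lemma bmeas_comp {R : realType} {d d' : measure_display} {T : measurableType d}
    {T' : measurableType d'} (W : T' -> R) (X : T -> T') :
  bmeas W -> measurable_fun setT X -> bmeas (fun w => W (X w)).
Proof.
by move=> [mW [b Wb]] mX; split; [exact: (measurableT_comp mW mX)|exists b].
Qed.

(** * Expectations under a measure of total mass 1, possibly a value of a kernel *)

Section expectation.
Context {R : realType} {d : measure_display} {T : measurableType d}.
Variable mu : {measure set T -> \bar R}.
Hypothesis mu1 : mu setT = 1%E.
Implicit Types (V W : T -> R) (k : R).

Lemma bmeas_integrable W : bmeas W -> mu.-integrable setT (EFin \o W).
Proof.
move=> [mW [b Wb]]; apply: measurable_bounded_integrable => //.
  by rewrite mu1 ltry.
exists b; split; first exact: num_real.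
by move=> x bx w _; exact: le_trans (Wb w) (ltW bx).
Qed.

Lemma bmeas_EFin_int W : bmeas W ->
  (\int[mu]_w (W w)%:E = (\int[mu]_w W w)%R%:E)%E.
Proof.
by move=> /bmeas_integrable iW; rewrite /Rintegral fineK// integrable_fin_num.
Qed.

Lemma ExD V W : bmeas V -> bmeas W ->
  \int[mu]_w (V w + W w) = \int[mu]_w V w + \int[mu]_w W w.
Proof. by move=> bV bW; rewrite RintegralD//; exact: bmeas_integrable. Qed.

Lemma ExB V W : bmeas V -> bmeas W ->
  \int[mu]_w (V w - W w) = \int[mu]_w V w - \int[mu]_w W w.
Proof. by move=> bV bW; rewrite RintegralB//; exact: bmeas_integrable. Qed.

Lemma ExZ k W : bmeas W -> \int[mu]_w (k * W w) = k * \int[mu]_w W w.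
Proof. by move=> bW; rewrite RintegralZl//; exact: bmeas_integrable. Qed.

Lemma Ex_cst k : \int[mu]_w (fun=> k) w = k.
Proof. by rewrite Rintegral_cst// mu1 mulr1. Qed.

Lemma Ex_le V W : bmeas V -> bmeas W -> (forall w, V w <= W w) ->
  \int[mu]_w V w <= \int[mu]_w W w.
Proof. by move=> bV bW VW; apply: le_Rintegral => //; exact: bmeas_integrable.
    Qed.

Lemma Ex_sum (n : nat) (V : nat -> T -> R) :
  (forall i, (i < n)%N -> bmeas (V i)) ->
  \int[mu]_w (\sum_(i < n) V i w) = \sum_(i < n) \int[mu]_w V i w.
Proof.
elim: n => [_|n IH bV].
  by under eq_Rintegral do rewrite big_ord0; rewrite big_ord0 Ex_cst.
under eq_Rintegral do rewrite big_ord_recr/=.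
have bV' i : (i < n)%N -> bmeas (V i) by move=> ?; exact/bV/ltnW.
by rewrite ExD ?IH ?big_ord_recr//=; [exact: bmeas_sum|exact: bV].
Qed.

Lemma Ex_indic (A : set T) : measurable A -> \int[mu]_w \1_A w = fine (mu A).
Proof. by move=> mA; rewrite /Rintegral integral_indic// setIT. Qed.

Lemma Ex_bound W k : bmeas W -> (forall w, `|W w| <= k) -> `|\int[mu]_w W w| <=
    k.
Proof.
move=> bW Wk; rewrite ler_norml -{1}(Ex_cst (- k)) -{2}(Ex_cst k).
apply/andP; split; apply: Ex_le => //; try exact: bmeas_cst.
  by move=> w; have := Wk w; rewrite ler_norml => /andP[].
by move=> w; have := Wk w; rewrite ler_norml => /andP[].
Qed.

Lemma Ex_ae V W : bmeas V -> bmeas W -> ae_eq mu setT V W ->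
  \int[mu]_w V w = \int[mu]_w W w.
Proof.
move=> [mV _] [mW _] VW; rewrite /Rintegral; congr fine.
apply: ae_eq_integral => //; try exact/measurable_EFinP.
by apply: filterS VW => w /= VW /VW ->.
Qed.

End expectation.

(** * Functions measurable for a generated sigma-algebra *)

Section sub_sigma_algebra.
Context {R : realType} {d : measure_display} {T : measurableType d}.
Implicit Types (g h : set (set T)) (W : T -> R).

(** The ascription only retypes the domain as the measurable space generated by [g], so every
    closure lemma for [bmeas] applies as it stands. *)
Definition bmeas_on g W := bmeas (W : g_sigma_algebraType g -> R).

Lemma gen_measurable g : g `<=` measurable -> <<s g>> `<=` measurable.
Proof. by move=> gm; apply: smallest_sub => //; exact:
    sigma_algebra_measurable. Qed.

Lemma bmeas_on_meas g W : g `<=` measurable -> bmeas_on g W -> bmeas W.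
Proof.
move=> gm [mW bW]; split => // mT B mB; apply: (gen_measurable gm).
exact: mW.
Qed.

Lemma gen_le g h : g `<=` <<s h>> -> <<s g>> `<=` <<s h>>.
Proof. by move=> gh; apply: smallest_sub => //; exact: smallest_sigma_algebra.
    Qed.

Lemma bmeas_on_le g h W : g `<=` <<s h>> -> bmeas_on g W -> bmeas_on h W.
Proof. by move=> gh [mW bW]; split => // mT B mB; apply: (gen_le gh); exact:
    mW. Qed.

Lemma bmeas_on_indic g (D : set T) : <<s g>> D -> bmeas_on g \1_D.
Proof. by move=> gD; apply: (@bmeas_indic R _ (g_sigma_algebraType g)). Qed.

End sub_sigma_algebra.

(** * Orthogonality to a sub-sigma-algebra *)

Section orthogonality.
Context {R : realType} {d : measure_display} {T : measurableType d}.
Variable P : probability T R.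
Implicit Types (g h Q : set (set T)) (W Z : T -> R).

Lemma integrable_bmeasM W Z : bmeas W -> P.-integrable setT (EFin \o Z) ->
  P.-integrable setT (EFin \o (fun w => W w * Z w)).
Proof.
move=> [mW [b Wb]] iZ.
have mZ : measurable_fun setT Z by apply/measurable_EFinP/(measurable_int P).
have ib : P.-integrable setT (fun w => b%:E * (EFin \o Z) w)%E.
  exact: integrableZl.
apply: le_integrable ib => //.
  by apply/measurable_EFinP; exact: measurable_funM.
move=> w _ /=; rewrite lee_fin !normrM ler_wpM2r//.
by rewrite (le_trans (Wb w))// ler_norm.
Qed.

Lemma Rintegral_indicM (D : set T) Z :
  \int[P]_(w in D) Z w = \int[P]_w (\1_D w * Z w).
Proof.
rewrite Rintegral_mkcond; apply: eq_Rintegral => w _.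
by rewrite patchE indicE; case: (_ \in _); rewrite ?mul1r ?mul0r.
Qed.

(** Vanishing on events passes to simple functions by linearity, and to [W] by uniform
    approximation, with an error of at most [eps] times E|Z|. *)
Lemma orthogonal_bmeas g W Z : g `<=` measurable ->
  P.-integrable setT (EFin \o Z) ->
  (forall D, <<s g>> D -> \int[P]_(w in D) Z w = 0) ->
  bmeas_on g W -> \int[P]_w (W w * Z w) = 0.
Proof.
move=> gm iZ Z0 gW.
have mZ : measurable_fun setT Z by apply/measurable_EFinP/(measurable_int P).
have iaZ : P.-integrable setT (EFin \o (fun w => `|Z w|)).
  exact: (integrable_norm iZ).
have bW : bmeas W by exact: bmeas_on_meas gW.
set K := \int[P]_w `|Z w|.
have K0 : 0 <= K by apply: Rintegral_ge0.
suff small eps : 0 < eps -> `|\int[P]_w (W w * Z w)| <= eps * K.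
  apply/eqP; rewrite -normr_le0; apply/ler_addgt0Pr => e e0; rewrite add0r.
  (* [K] may be 0, hence the division by [K + 1]. *)
  have K1 : 0 < K + 1 by lra.
  apply: le_trans (small (e / (K + 1)) _) _; first by rewrite divr_gt0.
  by rewrite mulrAC ler_pdivrMr// ler_pM2l//; lra.
move=> e0; have [n [c [B [mB WB]]]] := bmeas_simple_approx gW e0.
pose A j : set T := B j.
have gA j : <<s g>> (A j) by exact: mB.
have bA j : bmeas (fun w => c j * \1_(A j) w : R).
  by apply: bmeasZ; apply: bmeas_indic; exact: (gen_measurable gm).
pose V w := \sum_(j < n) c j * \1_(A j) w.
have bV k : bmeas (fun w => \sum_(j < k) c j * \1_(A j) w).
  by apply: (bmeas_sum (V := fun j w => c j * \1_(A j) w)).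
have VZ0 : \int[P]_w (V w * Z w) = 0.
  have -> : \int[P]_w (V w * Z w) =
      \sum_(j < n) c j * \int[P]_w (\1_(A j) w * Z w).
    rewrite /V; elim: (n) => [|k IH].
      under eq_Rintegral do rewrite big_ord0 mul0r.
      by rewrite big_ord0 Rintegral_cst// mul0r.
    under eq_Rintegral do rewrite big_ord_recr/= mulrDl -mulrA.
    have ? : P.-integrable setT (EFin \o (fun w => \1_(A k) w * Z w)).
      by apply: integrable_bmeasM => //; apply: bmeas_indic; exact:
          (gen_measurable gm).
    rewrite RintegralD// ?IH ?RintegralZl// ?big_ord_recr//.
      by apply: integrable_bmeasM => //; exact: bV.
    by apply: (@integrable_bmeasM (fun=> c k)) => //; exact: bmeas_cst.
  by rewrite big1// => j _; rewrite -Rintegral_indicM Z0 ?mulr0//; exact: gA.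
have bWV : bmeas (fun w => W w - V w) by apply: bmeasB => //; exact: bV.
have -> : \int[P]_w (W w * Z w) = \int[P]_w ((W w - V w) * Z w).
  rewrite -[LHS]subr0 -VZ0 -RintegralB//.
  - by apply: eq_Rintegral => w _; rewrite mulrBl.
  - exact: integrable_bmeasM.
  - by apply: integrable_bmeasM => //; exact: bV.
apply: le_trans (le_normr_Rintegral _ _) _ => //; first exact:
    integrable_bmeasM.
rewrite -RintegralZl//; apply: le_Rintegral => //.
- exact: (integrable_norm (integrable_bmeasM bWV iZ)).
- by apply: (@integrable_bmeasM (fun=> eps)) => //; exact: bmeas_cst.
- by move=> w _; rewrite normrM ler_wpM2r//; exact: WB.
Qed.

(** The events over which [Z] integrates to 0 form a Dynkin system: closure under complement is
    exactly what the vanishing total integral gives. *)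
Lemma orthogonal_dynkin Q Z : Q `<=` measurable -> setI_closed Q ->
  P.-integrable setT (EFin \o Z) -> \int[P]_w Z w = 0 ->
  (forall D, Q D -> \int[P]_(w in D) Z w = 0) ->
  forall D, <<s Q>> D -> \int[P]_(w in D) Z w = 0.
Proof.
move=> Qm QI iZ ZT ZQ.
have sQm := gen_measurable Qm.
apply: (@dynkin_induction _ (g_sigma_algebraType Q) Q) => //.
- move=> S sS ZS; have mS : d.-measurable S := sQm S sS.
  have := ZT; rewrite -(setUv S) Rintegral_setU ?ZS ?add0r//.
  + exact: measurableC.
  + by rewrite setUv.
  + by rewrite disj_set2E setICr.
- move=> D mD tD ZD.
  have mD' k : d.-measurable (D k) := sQm _ (mD k).
  have iD : P.-integrable (\bigcup_k D k) (EFin \o Z).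
    by apply: integrableS iZ => //; exact: bigcup_measurable.
  rewrite /Rintegral integral_bigcup// eseries0// => k _ _.
  rewrite -[LHS]fineK; first by rewrite [X in X%:E](_ : _ = 0)//; exact: ZD.
  by apply: integrable_fin_num => //; exact: integrableS iZ.
Qed.

End orthogonality.

(** * Conditional probabilities and laws *)

Section conditional_probability.
Context {R : realType} {d : measure_display} {T : measurableType d}.
Variable P : probability T R.
Implicit Types (g h : set (set T)) (A D : set T) (W Z q : T -> R)
  (p : T -> \bar R).

(** The event where [p < p'] lies in the sigma-algebra, so both versions have the same integral over
    it; a positive difference with zero integral lives on a null set. *)
Lemma cond_prob_lt_null g A p p' : g `<=` measurable ->
  is_cond_prob P <<s g>> A p -> is_cond_prob P <<s g>> A p' ->
  P.-negligible [set w | (p w < p' w)%E].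
Proof.
move=> gm [mp ip Ep] [mp' ip' Ep'].
set D := [set w | _].
have gD : <<s g>> D.
  rewrite -[D]setTI.
  apply: (@measurable_lte _ (g_sigma_algebraType g) R setT measurableT p p').
    by move=> _ B mB; rewrite setTI; exact: mp.
  by move=> _ B mB; rewrite setTI; exact: mp'.
have mD : measurable D by exact: (gen_measurable gm).
have iD : P.-integrable D p by exact: integrableS ip.
have iD' : P.-integrable D p' by exact: integrableS ip'.
have : (\int[P]_(w in D) `|p' w - p w| = 0)%E.
  rewrite -[RHS](_ : \int[P]_(w in D) (p' w - p w) = 0)%E; last first.
    rewrite integralB// Ep'// -Ep// subee//; exact: integrable_fin_num.
  by apply: eq_integral => w; rewrite inE => Dw; rewrite gee0_abs//; apply:
      ltW; rewrite sube_gt0.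
have md : measurable_fun D (fun w => p' w - p w)%E.
  exact: measurable_int (integrableB mD iD' iD).
move/(ae_eq_integral_abs P mD md) => [N [mN N0 DN]]; exists N; split => // w
    Dw; apply: DN => /= /(_ Dw) e.
by have : (0 < p' w - p w)%E; [rewrite sube_gt0|rewrite e ltxx].
Qed.

Lemma cond_prob_unique g A p p' : g `<=` measurable ->
  is_cond_prob P <<s g>> A p -> is_cond_prob P <<s g>> A p' ->
  ae_eq P setT p p'.
Proof.
move=> gm cp cp'.
have := negligibleU (cond_prob_lt_null gm cp cp') (cond_prob_lt_null gm cp' cp).
apply: negligibleS => w /= /not_implyP[_ /eqP].
by rewrite neq_lt => /orP[]; [left|right].
Qed.

(** Translates the definition by integrals over events into orthogonality of a real function. An
    integrable version is finite almost surely, so [fine] changes it on a null set only. *)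
Lemma cond_prob_orthogonal g A p : g `<=` measurable -> measurable A ->
  is_cond_prob P <<s g>> A p ->
  P.-integrable setT (EFin \o (fun w => \1_A w - fine (p w))) /\
  forall D, <<s g>> D -> \int[P]_(w in D) (\1_A w - fine (p w)) = 0.
Proof.
move=> gm mA [mp ip Ep].
have mp' : measurable_fun setT p := measurable_int _ ip.
have pfin := integrable_ae measurableT ip.
have mfp : measurable_fun setT (EFin \o (fun w => fine (p w))).
  by apply/measurable_EFinP; exact: measurableT_comp.
have epf : ae_eq P setT p (EFin \o (fun w => fine (p w))).
  by apply: filterS pfin => w /= /(_ I) wf _; rewrite fineK.
have ifp : P.-integrable setT (EFin \o (fun w => fine (p w))).
  apply: le_integrable ip => // w _ /=.
  by case: (p w) => [r| |] //=; rewrite normr0 leey.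
have i1 : P.-integrable setT (EFin \o \1_A).
  by apply: bmeas_integrable; [exact: probability_setT|exact: bmeas_indic].
split=> [|D gD]; first by have := integrableB measurableT i1 ifp; apply:
    eq_integrable.
have mD : measurable D by exact: (gen_measurable gm).
rewrite RintegralB//; [|exact: integrableS i1|exact: integrableS ifp].
rewrite {1}/Rintegral integral_indic// /Rintegral.
rewrite -(@ae_eq_integral _ _ _ P D (EFin \o (fun w => fine (p w))) p)//.
- by rewrite Ep// subrr.
- exact: measurable_funS mp'.
- exact: measurable_funS mfp.
- exact: ae_eq_subset epf.
Qed.

Lemma cond_prob_Ex g A p W : g `<=` measurable -> measurable A ->
  is_cond_prob P <<s g>> A p -> bmeas_on g W ->
  \int[P]_w (W w * (\1_A w - fine (p w))) = 0.
Proof.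
move=> gm mA /(cond_prob_orthogonal gm mA)[iZ Z0] gW.
exact: orthogonal_bmeas gW.
Qed.

Lemma bmeas_on_cond_prob g A q : g `<=` measurable -> measurable A ->
  bmeas_on g q ->
  (forall D, <<s g>> D -> \int[P]_(w in D) (\1_A w - q w) = 0) ->
  is_cond_prob P <<s g>> A (EFin \o q).
Proof.
move=> gm mA gq q0.
have bq := bmeas_on_meas gm gq.
have iq := bmeas_integrable (probability_setT P) bq.
have iA := bmeas_integrable (probability_setT P) (@bmeas_indic R _ _ A mA).
split => //.
  move=> B mB; rewrite -[_ @^-1` _]setTI.
  by apply: ((measurable_EFinP (setT : set (g_sigma_algebraType g)) q).2 gq.1).
move=> D gD.
have mD : measurable D by exact: (gen_measurable gm).
have iqD := integrableS measurableT mD (@subsetT _ D) iq.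
have iAD := integrableS measurableT mD (@subsetT _ D) iA.
have := q0 D gD; rewrite RintegralB// => /subr0_eq.
rewrite {1}/Rintegral integral_indic// => e.
rewrite -[LHS]fineK; last exact: integrable_fin_num.
rewrite [X in X%:E](_ : _ = \int[P]_(w in D) q w)// -e fineK//.
by rewrite fin_num_measure//; exact: measurableI.
Qed.

(** If [A] is independent of [h] given [g], a version of its conditional probability given [g]
    remains one given [g] and [h] together. By the Dynkin argument this is checked on intersections
    of an event of each. *)
Lemma cond_indep_orthogonal g h (G1 : set (set T)) A q :
  g `<=` measurable -> h `<=` measurable -> measurable A ->
  cond_indep P <<s g>> G1 <<s h>> -> G1 A -> bmeas_on g q ->
  (forall D, <<s g>> D -> \int[P]_(w in D) (\1_A w - q w) = 0) ->
  forall D, <<s g `|` h>> D -> \int[P]_(w in D) (\1_A w - q w) = 0.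
Proof.
move=> gm hm mA ci G1A gq q0.
have cq := bmeas_on_cond_prob gm mA gq q0.
have bq := bmeas_on_meas gm gq.
have bA := @bmeas_indic R _ _ A mA.
have iZ : P.-integrable setT (EFin \o (fun w => \1_A w - q w)).
  by apply: bmeas_integrable; [exact: probability_setT|exact: bmeasB].
have sgm := gen_measurable gm.
have shm := gen_measurable hm.
pose Q := [set D | exists D1 D2, [/\ <<s g>> D1, <<s h>> D2 & D = D1 `&` D2]].
have gT : <<s g>> setT by exact: (@measurableT _ (g_sigma_algebraType g)).
have hT : <<s h>> setT by exact: (@measurableT _ (g_sigma_algebraType h)).
move=> D gD; have {gD} : <<s Q>> D.
  apply: gen_le gD => B [gB|hB]; apply: sub_gen_smallest.
    exists B, setT; split => //; last by rewrite setIT.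
    exact: sub_gen_smallest.
  exists setT, B; split => //; last by rewrite setTI.
  exact: sub_gen_smallest.
apply: orthogonal_dynkin => //.
- by move=> _ [D1 [D2 [/sgm m1 /shm m2 ->]]]; exact: measurableI.
- move=> _ _ [D1 [D2 [g1 h2 ->]]] [E1 [E2 [g1' h2' ->]]].
  exists (D1 `&` E1), (D2 `&` E2); split; last by rewrite setIACA.
    exact: (@measurableI _ (g_sigma_algebraType g)).
  exact: (@measurableI _ (g_sigma_algebraType h)).
- exact: q0.
move=> _ [D1 [D2 [g1 h2 ->]]].
have m1 := sgm _ g1; have m2 := shm _ h2.
have [p1 [p2 [c1 c2 c12]]] := ci A D2 G1A h2.
have b1 : bmeas (\1_D1 : T -> R) by exact: bmeas_indic.
have b2 : bmeas (\1_D2 : T -> R) by exact: bmeas_indic.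
have gq1 : bmeas_on g (fun w => \1_D1 w * q w).
  by apply: bmeasM gq; exact: bmeas_on_indic.
have := cond_prob_Ex gm m2 c2 gq1.
have := cond_prob_Ex gm (measurableI _ _ mA m2) c12 (bmeas_on_indic g1).
have [i12 _] := cond_prob_orthogonal gm (measurableI _ _ mA m2) c12.
have [i2 _] := cond_prob_orthogonal gm m2 c2.
(* Since [p1 = q] almost surely, the integrand 1_(D1 D2) (1_A - q) is the difference of 1_D1 (1_(A
   D2) - p1 p2) and 1_D1 q (1_D2 - p2), each of integral 0. *)
set I1 := Rintegral _ _ _ => I10; set I2 := Rintegral _ _ _ => I20.
have ->: \int[P]_(w in D1 `&` D2) (\1_A w - q w) = I1 - I2; last first.
  by rewrite I10 I20 subrr.
rewrite /I1 /I2 -RintegralB//; last first.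
- by apply: integrable_bmeasM => //; exact: bmeasM.
- exact: integrable_bmeasM.
rewrite Rintegral_indicM /Rintegral; congr fine.
have iprod : P.-integrable setT (EFin \o (fun w => \1_(D1 `&` D2) w * (\1_A w -
    q w))).
  by apply: integrable_bmeasM => //; apply: bmeas_indic; exact: measurableI.
have idiff := integrableB measurableT (integrable_bmeasM b1 i12)
  (integrable_bmeasM (bmeasM b1 bq) i2).
apply: ae_eq_integral => //; [exact: measurable_int iprod|exact: measurable_int
    idiff|].
have [_ ip2 _] := c2.
have := integrable_ae measurableT ip2.
apply: filterS2 (cond_prob_unique gm c1 cq) => w /= /(_ I) -> /(_ I) wf _.
rewrite -(fineK wf)/= !indicE !in_setI; congr EFin.
by do 3 case: (_ \in _) => /=; ring.
Qed.

(** The product of the conditional probabilities has integral P(A1 A2) = 0, while it is at least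
    half of [k2], whose integral is P(A2). *)
Lemma cond_indep_null g (G1 G2 : set (set T)) A1 A2 (k1 k2 : T -> \bar R) :
  g `<=` measurable -> measurable A2 ->
  cond_indep P <<s g>> G1 G2 -> G1 A1 -> G2 A2 ->
  is_cond_prob P <<s g>> A1 k1 -> is_cond_prob P <<s g>> A2 k2 ->
  (forall w, 2^-1%:E <= k1 w)%E -> (forall w, 0 <= k2 w)%E ->
  P (A1 `&` A2) = 0 -> P A2 = 0.
Proof.
move=> gm m2 ci G1A G2A c1 c2 k1h k20 P0.
have [p1 [p2 [d1 d2 d12]]] := ci _ _ G1A G2A.
have gT : <<s g>> setT by exact: (@measurableT _ (g_sigma_algebraType g)).
have [_ ik1 _] := c1; have [_ ik2 Ek2] := c2; have [_ i12 E12] := d12.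
have mk1 := measurable_int _ ik1; have mk2 := measurable_int _ ik2.
have := E12 setT gT; rewrite setIT P0.
rewrite (@ae_eq_integral _ _ _ P setT (fun w => k1 w * k2 w)%E (fun w => p1 w *
    p2 w)%E)//; last 3 first.
- exact: measurable_int i12.
- exact: emeasurable_funM.
- apply: filterS2 (cond_prob_unique gm d1 c1) (cond_prob_unique gm d2 c2).
  by move=> w /= /(_ I) -> /(_ I) ->.
move=> k0; apply/eqP; rewrite eq_le measure_ge0 andbT.
have -> : P A2 = (\int[P]_w k2 w)%E by rewrite Ek2// setIT.
rewrite -(@pmule_rle0 _ 2^-1%:E) ?lte_fin ?invr_gt0//.
rewrite -k0 -ge0_integralZl//.
apply: ge0_le_integral => //.
- by move=> w _; rewrite mule_ge0// lee_fin invr_ge0.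
- exact: emeasurable_funM.
- exact: emeasurable_funM.
- by move=> w _; rewrite lee_wpmul2r.
Qed.

End conditional_probability.

Section conditional_law.
Context {R : realType} {d dE : measure_display} {T : measurableType d}
  {E : measurableType dE}.

Lemma bmeas_kernel_integral (k : T -> {measure set E -> \bar R}) (phi : E -> R)
    :
  (forall w, k w setT = 1%E) ->
  (forall B, measurable B -> measurable_fun setT (fun w => k w B)) ->
  bmeas phi -> bmeas (fun w => \int[k w]_x phi x).
Proof.
move=> k1 mk bphi; have [mphi [b phib]] := bphi.
split; last by exists b => w; exact: (Ex_bound (k1 w)).
have bp : bmeas (fun x => phi x + b) by apply: bmeasD => //; exact: bmeas_cst.
(* Shifting by the bound makes the integrand nonnegative, the case in which a kernel integral is
   measurable. *)
have -> : (fun w => \int[k w]_x phi x) =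
    (fun w => fine (\int[k w]_x (phi x + b)%:E)%E - b).
  apply/funext => w; have := ExD (k1 w) bphi (bmeas_cst b).
  by rewrite (Ex_cst (k1 w)) /Rintegral => ->; rewrite addrK.
apply: measurable_funB => //; apply: measurableT_comp => //.
apply: measurable_fun_integral_kernel => //.
  by move=> x; rewrite lee_fin; have := phib x; rewrite ler_norml; lra.
by apply/measurable_EFinP; exact: bp.1.
Qed.

(** The kernel mean of [phi] is the conditional expectation of [phi (X w)]: for indicators this is
    the definition of a conditional law, and uniform approximation does the rest. *)
Lemma cond_law_orthogonal (P : probability T R) (g : set (set T)) (X : T -> E)
    (k : T -> {measure set E -> \bar R}) (phi : E -> R) :
  g `<=` measurable -> measurable_fun setT X ->
  (forall w, k w setT = 1%E) ->
  is_cond_law P <<s g>> X (fun w => k w) -> bmeas phi ->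
  bmeas (fun w => \int[k w]_x phi x) ->
  forall D, <<s g>> D ->
    \int[P]_(w in D) (phi (X w) - \int[k w]_x phi x) = 0.
Proof.
move=> gm mX k1 kX bphi bm D gD.
have mD : measurable D by exact: (gen_measurable gm).
have P1 := probability_setT P.
have bD : bmeas (\1_D : T -> R) by exact: bmeas_indic.
have bZ : bmeas (fun w => phi (X w) - \int[k w]_x phi x).
  by apply: bmeasB => //; exact: bmeas_comp.
rewrite Rintegral_indicM.
apply/eqP; rewrite -normr_le0; apply/ler_addgt0Pr => e e0; rewrite add0r.
(* The error enters twice, through [phi (X w)] and through its kernel mean. *)
have e20 : 0 < e / 2 by lra.
have [n [c [B [mB phiB]]]] := bmeas_simple_approx bphi e20.
have bB j : bmeas (\1_(B j) : E -> R) by exact: bmeas_indic.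
pose psi x := \sum_(j < n) c j * \1_(B j) x.
have bpsi : bmeas psi.
  by apply: (bmeas_sum (V := fun j x => c j * \1_(B j) x)) => j _; exact:
      bmeasZ.
pose Zj j w : R := \1_(X @^-1` B j) w - fine (k w (B j)).
have mXB j : measurable (X @^-1` B j) by rewrite -[_ @^-1` _]setTI; exact: mX.
have bZj j : bmeas (Zj j).
  apply: bmeasB; first exact: bmeas_indic.
  split; last first.
    exists 1 => w; rewrite ger0_norm ?fine_ge0//.
    rewrite -lee_fin fineK; first by rewrite -(k1 w) le_measure// inE.
    rewrite ge0_fin_numE//; apply: le_lt_trans (ltry 1).
    by rewrite -(k1 w) le_measure// inE.
  apply: measurableT_comp => //.
  by have [_ /measurable_int] := kX _ (mB j).
have psiE w : psi (X w) - \int[k w]_x psi x = \sum_(j < n) c j * Zj j w.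
  rewrite (Ex_sum (k1 w) (V := fun j x => c j * \1_(B j) x)); last first.
    by move=> j _; exact: bmeasZ.
  rewrite /psi -sumrB; apply: eq_bigr => j _.
  by rewrite (ExZ (k1 w))// (Ex_indic _)// -mulrBr.
have bDZ j : bmeas (fun w => c j * (\1_D w * Zj j w)).
  by apply: bmeasZ; exact: bmeasM.
pose S w := \sum_(j < n) c j * (\1_D w * Zj j w).
have bS : bmeas S by exact: (bmeas_sum (V := fun j w => c j * (\1_D w * Zj j
    w))).
have S0 : \int[P]_w S w = 0.
  rewrite (Ex_sum P1 (V := fun j w => c j * (\1_D w * Zj j w)))//.
  rewrite big1// => j _; rewrite (ExZ P1); last exact: bmeasM.
  rewrite -Rintegral_indicM; have [_ ->//] := cond_prob_orthogonal gm (mXB j)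
      (kX _ (mB j)).
  by rewrite mulr0.
have bDZ' : bmeas (fun w => \1_D w * (phi (X w) - \int[k w]_x phi x)) by exact:
    bmeasM.
rewrite -[X in `|X|]subr0 -S0 -(ExB P1)//; apply: (Ex_bound P1).
  exact: bmeasB.
move=> w; rewrite /S.
under eq_bigr do rewrite mulrCA.
rewrite -mulr_sumr -psiE -mulrBr normrM.
have D1 : `|\1_D w : R| <= 1 by rewrite indicE; case: (_ \in _); rewrite
    ?normr1 ?normr0.
apply: le_trans (ler_wpM2r (normr_ge0 _) D1) _; rewrite mul1r.
rewrite [X in `|X|](_ : _ =
  (phi (X w) - psi (X w)) - (\int[k w]_x phi x - \int[k w]_x psi x)); last by
      ring.
rewrite (splitr e) (le_trans (ler_normB _ _))// lerD//.
by rewrite -(ExB (k1 w))//; apply: (Ex_bound (k1 w)) => //; exact: bmeasB.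
Qed.

End conditional_law.

(** * Second moments and variance *)

Section second_moments.
Context {R : realType} {d : measure_display} {T : measurableType d}.
Variable P : probability T R.
Implicit Types (V W X : T -> R) (a : nat -> T -> R).

Let P1 := probability_setT P.

Lemma Ex_sqrD V W : bmeas V -> bmeas W ->
  \int[P]_w (V w + W w) ^+ 2 =
  \int[P]_w V w ^+ 2 + 2 * \int[P]_w (V w * W w) + \int[P]_w W w ^+ 2.
Proof.
move=> bV bW.
have bVW := bmeasM bV bW.
rewrite -(ExZ P1)// -(ExD P1)//; [|exact: bmeas_sqr|exact: bmeasZ].
rewrite -(ExD P1)//; [|by apply: bmeasD; [exact: bmeas_sqr|exact:
    bmeasZ]|exact: bmeas_sqr].
by apply: eq_Rintegral => w _; ring.
Qed.

(** Pythagoras for martingale differences: each term is orthogonal to the partial sum before it, so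
    all cross terms vanish. *)
Lemma Ex_sqr_orthogonal_sum a (n : nat) (b : R) :
  (forall i, (i < n)%N -> bmeas (a i)) ->
  (forall k, (k < n)%N -> \int[P]_w ((\sum_(i < k) a i w) * a k w) = 0) ->
  (forall k, (k < n)%N -> \int[P]_w a k w ^+ 2 <= b) ->
  \int[P]_w (\sum_(i < n) a i w) ^+ 2 <= n%:R * b.
Proof.
elim: n => [|n IH] ba a0 ab.
  under eq_Rintegral do rewrite big_ord0 expr0n/=.
  by rewrite (Ex_cst P1) mul0r.
have ba' i : (i < n)%N -> bmeas (a i) by move=> /ltnW; exact: ba.
under eq_Rintegral do rewrite big_ord_recr/=.
rewrite Ex_sqrD; [|exact: bmeas_sum|exact: ba].
rewrite a0// mulr0 addr0 -natr1 mulrDl mul1r lerD//; last exact: ab.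
by apply: IH => // k /ltnW; [exact: a0|exact: ab].
Qed.

(** Minkowski's inequality by induction, where [v i] bounds the L2 norm of [a i]. In place of
    Cauchy-Schwarz the cross term is bounded by AM-GM, weighted by the ratio of the two norm bounds
    so that both halves contribute V v / 2. *)
Lemma Ex_sqr_minkowski a (v : nat -> R) (n : nat) :
  (forall i, (i < n)%N -> bmeas (a i)) -> (forall i, (i < n)%N -> 0 < v i) ->
  (forall i, (i < n)%N -> \int[P]_w a i w ^+ 2 <= v i ^+ 2) ->
  \int[P]_w (\sum_(i < n) a i w) ^+ 2 <= (\sum_(i < n) v i) ^+ 2.
Proof.
elim: n => [|n IH] ba v0 av.
  under eq_Rintegral do rewrite big_ord0 expr0n/=.
  by rewrite (Ex_cst P1) big_ord0 expr0n.
have ba' i : (i < n)%N -> bmeas (a i) by move=> /ltnW; exact: ba.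
have {}IH : \int[P]_w (\sum_(i < n) a i w) ^+ 2 <= (\sum_(i < n) v i) ^+ 2.
  by apply: IH => // i /ltnW; [exact: v0|exact: av].
under eq_Rintegral do rewrite big_ord_recr/=.
rewrite [X in _ <= X ^+ 2]big_ord_recr/=.
(* The weights divide by [V], which is 0 for the empty sum; a single term is therefore treated
   apart. *)
case: n ba av v0 ba' IH => [|n] ba av v0 ba' IH.
  under eq_Rintegral do rewrite big_ord0 add0r.
  by rewrite big_ord0 add0r; exact: av.
have vn := v0 n.+1 (ltnSn _).
set V := \sum_(i < n.+1) v i in IH *; set A := (fun w => \sum_(i < n.+1) a i w)
    in IH *.
have V0 : 0 < V.
  rewrite /V big_ord_recr/= ltr_wpDl ?v0// sumr_ge0// => i _.
  by rewrite ltW// v0// (ltn_trans (ltn_ord i))// ltnW.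
have bA : bmeas A by exact: bmeas_sum.
have bn : bmeas (a n.+1) by exact: ba.
rewrite Ex_sqrD// sqrrD !lerD//; last exact: av.
(* AM-GM: [2 x y <= (v / V) x^2 + (V / v) y^2] *)
have : \int[P]_w (A w * a n.+1 w) <= \int[P]_w
    ((v n.+1 / V / 2) * A w ^+ 2 + (V / v n.+1 / 2) * a n.+1 w ^+ 2).
  apply: (Ex_le P1).
  - exact: bmeasM.
  - by apply: bmeasD; apply: bmeasZ; exact: bmeas_sqr.
  move=> w; have t0 : 0 < v n.+1 / V by rewrite divr_gt0.
  rewrite -[V / v n.+1]invf_div.
  set t := v n.+1 / V in t0 *; rewrite -subr_ge0.
  rewrite (_ : _ - _ = t / 2 * (A w - t^-1 * a n.+1 w) ^+ 2).
    by rewrite mulr_ge0 ?sqr_ge0// divr_ge0// ltW.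
  by field; rewrite gt_eqF.
have bA2 : bmeas (fun w => v n.+1 / V / 2 * A w ^+ 2) by apply: bmeasZ; exact:
    bmeas_sqr.
have ba2 : bmeas (fun w => V / v n.+1 / 2 * a n.+1 w ^+ 2) by apply: bmeasZ;
    exact: bmeas_sqr.
rewrite (ExD P1)// (ExZ P1); last exact: bmeas_sqr.
rewrite (ExZ P1); last exact: bmeas_sqr.
move=> h; rewrite -[leRHS]mulr_natl ler_pM2l//.
apply: le_trans h _.
rewrite [leRHS](_ : _ = v n.+1 / V / 2 * V ^+ 2 + V / v n.+1 / 2 * v n.+1 ^+
    2); last first.
  by field; rewrite !gt_eqF.
by apply: lerD; apply: ler_wpM2l => //; rewrite ?divr_ge0// ?(ltW vn)// ?(ltW
    V0)//; exact: av.
Qed.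

(** The mean minimises the second moment about a point, so any convenient centre [k] gives an upper
    bound. *)
Lemma variance_le_sqr X X' k : measurable_fun setT X -> bmeas X' ->
  ae_eq P setT X X' -> ('V_P[X] <= (\int[P]_w (X' w - k) ^+ 2)%:E)%E.
Proof.
move=> mX bX' XX'.
have mX' := bX'.1.
rewrite /variance !unlock.
have eX : fine (\int[P]_w (X w)%:E)%E = \int[P]_w X' w.
  rewrite /Rintegral; congr fine; apply: ae_eq_integral => //.
  - exact/measurable_EFinP.
  - exact/measurable_EFinP.
  - by apply: filterS XX' => w /= e /e ->.
rewrite eX; set m := \int[P]_w X' w.
have bXm : bmeas (fun w => X' w - m) by apply: bmeasB => //; exact: bmeas_cst.
have bc := @bmeas_cst R _ T (m - k).
have -> : (\int[P]_w (((X \- cst m) * (X \- cst m)) w)%:E)%E =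
    (\int[P]_w (X' w - m) ^+ 2)%:E.
  rewrite -(bmeas_EFin_int P1); last first.
    by under eq_fun do rewrite expr2; exact: bmeasM.
  apply: ae_eq_integral => //.
  - by apply/measurable_EFinP; apply: measurable_funM; exact: measurable_funB.
  - by apply/measurable_EFinP; under eq_fun do rewrite expr2; exact: (bmeasM
      bXm bXm).1.
  - by apply: filterS XX' => w /= e /e ew; rewrite expr2 /= !fctE -ew.
rewrite lee_fin [leRHS](_ : _ = \int[P]_w ((X' w - m) + (m - k)) ^+ 2); last
    first.
  by apply: eq_Rintegral => w _; rewrite subrKA.
rewrite (Ex_sqrD bXm bc).
under [in X in _ <= _ + X + _]eq_Rintegral do rewrite mulrC.
rewrite (ExZ P1)// (ExB P1)//; last exact: bmeas_cst.
rewrite !(Ex_cst P1) subrr !mulr0 addr0 lerDl.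
by rewrite sqr_ge0.
Qed.

End second_moments.

(** * Inverse square roots, discrete variables and clipping *)

Lemma sqr_norm_le (R : realDomainType) (x b : R) : `|x| <= b -> x ^+ 2 <= b ^+
    2.
Proof.
by move=> xb; rewrite -(real_normK (num_real x)) lerXn2r// nnegrE (le_trans _
    xb).
Qed.

(** With x and y the roots of n and n + 1, the induction step 2 x + 1 / y <= 2 y amounts to (y -
    x)^2 >= 0, because y^2 = x^2 + 1. *)
Lemma sum_inv_sqrt_le (R : realType) (n : nat) :
  \sum_(i < n) (Num.sqrt (n - i)%:R)^-1 <= 2 * Num.sqrt n%:R :> R.
Proof.
rewrite (reindex_inj rev_ord_inj)/=.
rewrite (eq_bigr (fun i : 'I_n => (Num.sqrt i.+1%:R)^-1)); last first.
  by move=> i _; rewrite subKn.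
elim: n => [|n IH]; first by rewrite big_ord0 mulr_ge0// sqrtr_ge0.
rewrite big_ord_recr/= (le_trans (lerD IH (lexx _)))//.
set x := Num.sqrt n%:R; set y := Num.sqrt n.+1%:R.
have x0 : 0 <= x by exact: sqrtr_ge0.
have y0 : 0 < y by rewrite sqrtr_gt0.
have xy : y ^+ 2 = x ^+ 2 + 1 by rewrite !sqr_sqrtr// natr1.
rewrite -(ler_pM2r y0) mulrDl mulVf ?gt_eqF//.
have : 0 <= (y - x) ^+ 2 by rewrite sqr_ge0.
nra.
Qed.

Lemma measurable_preimage_fin (d : measure_display) (T : measurableType d)
    (F : finType) (X : T -> F) (B : set F) :
  (forall f, measurable (X @^-1` [set f])) -> measurable (X @^-1` B).
Proof.
move=> mX; have -> : X @^-1` B = \bigcup_(f in B) X @^-1` [set f].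
  apply/seteqP; split => [w Bw|w [f Bf]]; first by exists (X w).
  by move=> /= Xw; rewrite Xw.
by apply: fin_bigcup_measurable => //; exact: finite_finset.
Qed.

Lemma bmeas_fin (R : realType) (d : measure_display) (T : measurableType d)
    (F : finType) (X : T -> F) (phi : F -> R) :
  (forall f, measurable (X @^-1` [set f])) -> bmeas (fun w => phi (X w)).
Proof.
move=> mX; split.
  move=> _ B mB; rewrite setTI.
  exact: (measurable_preimage_fin (phi @^-1` B) mX).
exists (\sum_f `|phi f|) => w; rewrite (bigD1 (X w))//= lerDl.
by apply: sumr_ge0.
Qed.

(* The measurements are bounded only almost surely; clipping makes them bounded
   everywhere and changes them on a null set only. *)
Definition clip {R : realType} (L x : R) : R := Num.max (- L) (Num.min L x).

Lemma clip_le (R : realType) (L x : R) : 0 <= L -> `|clip L x| <= L.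
Proof.
move=> L0; rewrite /clip ler_norml le_max lexx/= ge_max; apply/andP; split;
    first by lra.
by rewrite ge_min lexx.
Qed.

Lemma clip_id (R : realType) (L x : R) : `|x| <= L -> clip L x = x.
Proof.
rewrite ler_norml => /andP[Lx xL]; rewrite /clip.
by rewrite min_r// max_r.
Qed.

Lemma bmeas_clip (R : realType) (L : R) : 0 <= L -> bmeas (clip L).
Proof.
move=> L0; split; last by exists L => x; exact: clip_le.
by apply: measurable_maxr => //; exact: measurable_minr.
Qed.

Lemma measurable_norm_le (R : realType) (r : R) : measurable [set x : R | `|x|
    <= r].
Proof.
rewrite -[X in measurable X]setTI.
by apply: (@measurable_fun_ler _ _ _ setT (fun x : R => `|x|) (fun=> r)).
Qed.

(** Continuity from below along the balls of integer radius: were all their masses under 1/2, the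
    limit 1 would be at most 1/2. *)
Lemma probability_ball_ge_half (R : realType) (mu : probability R R) :
  exists2 K : R, 0 <= K & (2^-1%:E <= mu [set x | (`|x| <= K)%R])%E.
Proof.
pose B (k : nat) := [set x : R | `|x| <= k%:R].
have BT : \bigcup_k B k = setT.
  apply/seteqP; split => // x _; exists (Num.truncn `|x|).+1 => //=.
  by rewrite /B/= ltW// truncnS_gt.
have cvgB : mu (B k) @[k --> \oo] --> (1 : \bar R)%E.
  rewrite -(probability_setT mu) -BT; apply: nondecreasing_cvg_mu.
  - by move=> k; exact: measurable_norm_le.
  - by rewrite BT.
  - by move=> i j ij; apply/subsetPset => x; rewrite /B/= => /le_trans; apply;
      rewrite ler_nat.
have [k hk] : exists k, (2^-1%:E <= mu (B k))%E.
  apply: contrapT => /forallNP h.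
  have : (1 <= 2^-1%:E :> \bar R)%E.
    rewrite -(cvg_lim _ cvgB)//; apply: lime_le; first by apply/cvg_ex; exists
        1%E.
    by near=> k; move: (h k) => /negP; rewrite -ltNge => /ltW.
  by rewrite lee_fin; lra.
by exists k%:R.
Unshelve. all: by end_near. Qed.

(** * Sequential and delta designs *)

Lemma events_before_sub (T E : Type) (ES : set (set E)) (X : nat -> T -> E)
    (i j : nat) : (j < i)%N ->
  preimage_set_system setT (X j) ES `<=` events_before ES X i.
Proof. by move=> ji A XA; exists j. Qed.

Lemma bmeas_on_fin (R : realType) (d : measure_display) (T : measurableType d)
    (F : finType) (g : set (set T)) (X : T -> F) (phi : F -> R) :
  preimage_set_system setT X setT `<=` <<s g>> -> bmeas_on g (fun w => phi (X
      w)).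
Proof.
move=> Xg; apply: (@bmeas_fin R _ (g_sigma_algebraType g)) => f.
by rewrite -[_ @^-1` _]setTI; apply: Xg; exists [set f].
Qed.

Lemma bmeas_on_comp (R : realType) (d dE : measure_display)
    (T : measurableType d) (E : measurableType dE) (g : set (set T))
    (X : T -> E) (phi : E -> R) :
  preimage_set_system setT X measurable `<=` <<s g>> -> bmeas phi ->
  bmeas_on g (fun w => phi (X w)).
Proof.
move=> Xg bphi.
apply: (@bmeas_comp R _ _ (g_sigma_algebraType g) E phi X) => // _ B mB.
by apply: Xg; exists B.
Qed.

Section designs.
Context {R : realType} {F : finType} {dU : measure_display}
  {U : measurableType dU} {C : Type}.
Variables (s : system R F U C) (n : nat) (e : experiment R F U C).
Implicit Types (i j k : nat) (f : F).

(** The past at the draw of [prog i], with [state i] already present. The bracketing follows the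
    order of enlargement: programs, then times, then states. *)
Definition draw_events i :=
  (prog_before e i `|` time_before e i) `|` state_before e i.+1.

(** The past when [time i] is measured, written exactly as the sigma-algebra [G] of
    [delta_additive]. *)
Definition run_events i :=
  prog_before e i.+1 `|` state_before e i.+1 `|` time_before e i.

Lemma prog_draw i j : (j < i)%N -> prog_at e j `<=` <<s draw_events i>>.
Proof.
move=> ji A pA; apply: sub_gen_smallest; left; left.
exact: events_before_sub pA.
Qed.

Lemma state_draw i j : (j <= i)%N ->
  preimage_set_system setT (state e j) measurable `<=` <<s draw_events i>>.
Proof.
move=> ji A pA; apply: sub_gen_smallest; right.
by apply: events_before_sub pA; rewrite ltnS.
Qed.

Lemma prog_run i j : (j <= i)%N -> prog_at e j `<=` <<s run_events i>>.
Proof.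
move=> ji A pA; apply: sub_gen_smallest; left; left.
by apply: events_before_sub pA; rewrite ltnS.
Qed.

Lemma state_run i j : (j <= i)%N ->
  preimage_set_system setT (state e j) measurable `<=` <<s run_events i>>.
Proof.
move=> ji A pA; apply: sub_gen_smallest; left; right.
by apply: events_before_sub pA; rewrite ltnS.
Qed.

Lemma time_run i j : (j < i)%N ->
  preimage_set_system setT (time e j) measurable `<=` <<s run_events i>>.
Proof.
move=> ji A pA; apply: sub_gen_smallest; right.
exact: events_before_sub pA.
Qed.

Hypothesis hseq : sequential s n e.

Lemma prog_before_measurable i : (i <= n)%N -> prog_before e i `<=` measurable.
Proof.
move=> ni A [j /= ji [B _ <-]]; rewrite setTI.
apply: measurable_preimage_fin => f; apply: (seq_prog_measurable _ _ _ hseq).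
exact: leq_trans ji ni.
Qed.

Lemma time_before_measurable i : (i <= n)%N -> time_before e i `<=` measurable.
Proof.
move=> ni A [j /= ji [B mB <-]]; apply: (seq_time_measurable _ _ _ hseq) => //.
exact: leq_trans ji ni.
Qed.

Lemma state_before_measurable i : (i <= n)%N -> state_before e i.+1 `<=`
    measurable.
Proof.
move=> ni A [j /= ji [B mB <-]]; apply: (seq_state_measurable _ _ _ hseq) => //.
exact: leq_trans (ji : (j <= i)%N) ni.
Qed.

Lemma draw_events_measurable i : (i <= n)%N -> draw_events i `<=` measurable.
Proof.
move=> ni A [[]|]; [exact: prog_before_measurable|exact:
    time_before_measurable|].
exact: state_before_measurable.
Qed.

Lemma run_events_measurable i : (i < n)%N -> run_events i `<=` measurable.
Proof.
move=> ni A [[]|]; [exact: prog_before_measurable| |].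
- exact/state_before_measurable/ltnW.
- exact/time_before_measurable/ltnW.
Qed.

End designs.

Arguments draw_events {R F dU U C} e i.
Arguments run_events {R F dU U C} e i.

Section delta_designs.
Context {R : realType} {F : finType} {dU : measure_display}
  {U : measurableType dU} {C : Type}.
Variables (s : system R F U C) (a : additive_laws R F U C) (M K : R).
Variables (n : nat) (e : experiment R F U C) (c : C).
Hypothesis hdelta : delta_design s a M n e.
Hypothesis K0 : 0 <= K.
Hypothesis true_half : forall f,
  (2^-1%:E <= true_law a c f [set x | (`|x| <= K)%R])%E.
Implicit Types (i j k : nat) (f : F) (W : sample e -> R).

Let P := law e c.
Let hseq := delta_sequential _ _ _ _ _ hdelta.
(** [K + |M|] will bound the noise, and one more [|M|] the true run time as the difference of
    measurement and noise. *)
Let L := K + 2 * `|M|.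
Let L0 : 0 <= L. Proof. by rewrite addr_ge0// mulr_ge0. Qed.

(** Clipping under the integral keeps both means bounded by [L] for every program and every state,
    even for states of probability 0, where the noise law is unrestricted. *)
Definition true_mean (L : R) f := \int[true_law a c f]_x clip L x.
Definition noise_mean (L : R) (u : U) := \int[noise_law a c u]_y clip L y.

Lemma bmeas_noise_mean : bmeas (noise_mean L).
Proof.
apply: bmeas_kernel_integral; [exact: prob_kernel| |exact: bmeas_clip].
by move=> B mB; exact: measurable_kernel.
Qed.

Lemma noise_mean_le u : `|noise_mean L u| <= L.
Proof.
apply: Ex_bound; [exact: prob_kernel|exact: bmeas_clip|].
by move=> x; exact: clip_le.
Qed.

Lemma true_mean_le f : `|true_mean L f| <= L.
Proof.
apply: Ex_bound; [exact: probability_setT|exact: bmeas_clip|].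
by move=> x; exact: clip_le.
Qed.

Lemma time_clip_ae i : (i < n)%N ->
  ae_eq P setT (time e i) (fun w => clip L (time e i w)).
Proof.
move=> ni; apply: filterS (delta_bounded _ _ _ _ _ hdelta c i ni) => w /= tM _.
rewrite clip_id// (le_trans tM)// (le_trans (ler_norm M))// /L.
by have := K0; have := normr_ge0 M; lra.
Qed.

Definition run_noise i w :=
  clip L (time e i w) - true_mean L (prog e i w) - noise_mean L (state e i w).

Lemma bmeas_on_run_noise i j : (j < i)%N -> bmeas_on (run_events e i)
    (run_noise j).
Proof.
move=> ji; have ji' := ltnW ji; apply: bmeasB; first apply: bmeasB.
- by apply: bmeas_on_comp; [exact: time_run|exact: bmeas_clip].
- by apply: bmeas_on_fin; exact: prog_run.
- by apply: bmeas_on_comp; [exact: state_run|exact: bmeas_noise_mean].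
Qed.

Lemma bmeas_run_noise i : (i < n)%N -> bmeas (run_noise i).
Proof.
move=> ni; apply: bmeasB; first apply: bmeasB.
- by apply: bmeas_comp; [exact: bmeas_clip|exact: (seq_time_measurable _ _ _
    hseq)].
- by apply: bmeas_fin => f; exact: (seq_prog_measurable _ _ _ hseq).
- apply: bmeas_comp; first exact: bmeas_noise_mean.
  by apply: (seq_state_measurable _ _ _ hseq); exact: ltnW.
Qed.

Lemma run_noise_le i w : `|run_noise i w| <= 3 * L.
Proof.
have := clip_le (time e i w) L0; have := true_mean_le (prog e i w).
have := noise_mean_le (state e i w); rewrite /run_noise !ler_norml; lra.
Qed.

(** Clipping is not additive, so [X] and [Y] are clipped and centred separately, each by its own
    conditional law; the two residuals add up to [run_noise] wherever no clip is active, that is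
    almost surely. *)
Lemma run_noise_orthogonal i W : (i < n)%N -> bmeas_on (run_events e i) W ->
  \int[P]_w (W w * run_noise i w) = 0.
Proof.
move=> ni bW.
have gm := run_events_measurable hseq ni.
have P1 := probability_setT P.
have [X [Y [[mX mY] timeE lX lY iXY]]] := delta_additive _ _ _ _ _ hdelta c i
    ni.
have mball := @measurable_norm_le R.
have bp : bmeas (fun w => true_mean L (prog e i w)).
  by apply: bmeas_fin => f; exact: (seq_prog_measurable _ _ _ hseq).
have bn : bmeas (fun w => noise_mean L (state e i w)).
  apply: bmeas_comp bmeas_noise_mean _.
  by apply: (seq_state_measurable _ _ _ hseq); exact: ltnW.
have bX : bmeas (fun w => clip L (X w)) by apply: bmeas_comp mX; exact:
    bmeas_clip.
have bY : bmeas (fun w => clip L (Y w)) by apply: bmeas_comp mY; exact: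
    bmeas_clip.
have X0 : \int[P]_w (W w * (clip L (X w) - true_mean L (prog e i w))) = 0.
  apply: orthogonal_bmeas bW => //.
    by apply: (bmeas_integrable P1); exact: bmeasB.
  apply: (cond_law_orthogonal (k := fun w => true_law a c (prog e i w))) => //.
  - by move=> w; exact: probability_setT.
  - exact: bmeas_clip.
have Y0 : \int[P]_w (W w * (clip L (Y w) - noise_mean L (state e i w))) = 0.
  apply: orthogonal_bmeas bW => //.
    by apply: (bmeas_integrable P1); exact: bmeasB.
  apply: (cond_law_orthogonal (k := fun w => noise_law a c (state e i w))) =>
      //.
  - by move=> w; exact: prob_kernel.
  - exact: bmeas_clip.
set B1 := [set x : R | `|x| <= K].
set B2 := ~` [set x : R | `|x| <= K + `|M|].
have mB2 : measurable B2 by by apply: measurableC; exact: mball.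
(* the true run time lies in [-K, K] with conditional probability at least 1/2
   and is conditionally independent of the noise, so a noise beyond [K + |M|]
   would make [time] exceed [M] *)
have mXB1 : measurable (X @^-1` B1) by rewrite -[_ @^-1` _]setTI; exact: (mX
    measurableT _ (mball K)).
have mYB2 : measurable (Y @^-1` B2) by rewrite -[_ @^-1` _]setTI; exact: mY.
have bounded := delta_bounded _ _ _ _ _ hdelta c i ni.
have Ynull : P (Y @^-1` B2) = 0.
  apply: (cond_indep_null (A1 := X @^-1` B1) gm _ iXY _ _ (lX _ (mball K)) (lY
      _ mB2)) => //.
  - by exists B1; [exact: mball|rewrite setTI].
  - by exists B2; [|rewrite setTI].
  have [N [mN N0 sN]] := bounded.
  apply: (subset_measure0 _ mN) => //; first exact: measurableI.
  move=> w [/= Xw Yw]; apply: sN => /= tM; apply: Yw => /=.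
  have -> : Y w = time e i w - X w by rewrite timeE addrAC subrr add0r.
  rewrite (le_trans (ler_normB _ _))// addrC lerD//.
  by rewrite (le_trans tM)// ler_norm.
have Yae : {ae P, forall w, `|Y w| <= K + `|M|}.
  by exists (Y @^-1` B2); split.
(* Where [|time| <= M] and [|Y| <= K + |M|], also [|X| <= L], so all three clips are the
   identity. *)
have noiseE : ae_eq P setT (fun w => W w * run_noise i w)
    (fun w => W w * (clip L (X w) - true_mean L (prog e i w)) +
              W w * (clip L (Y w) - noise_mean L (state e i w))).
  apply: filterS2 bounded Yae => w /= tM Yw _.
  have MM : `|time e i w| <= `|M| by rewrite (le_trans tM)// ler_norm.
  have Xw : `|X w| <= L.
    have -> : X w = time e i w - Y w by rewrite timeE addrK.
    by rewrite (le_trans (ler_normB _ _))// /L; lra.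
  rewrite /run_noise !clip_id//; first by rewrite timeE; ring.
  - by rewrite /L; have := normr_ge0 M; lra.
  - by rewrite /L; have := normr_ge0 M; have := K0; lra.
have bW' := bmeas_on_meas gm bW.
have bXn : bmeas (fun w => W w * (clip L (X w) - true_mean L (prog e i w))).
  by apply: bmeasM => //; exact: bmeasB.
have bYn : bmeas (fun w => W w * (clip L (Y w) - noise_mean L (state e i w))).
  by apply: bmeasM => //; exact: bmeasB.
rewrite (Ex_ae _ _ noiseE); last 2 first.
- by apply: bmeasM => //; exact: bmeas_run_noise.
- exact: bmeasD.
by rewrite (ExD P1)// X0 Y0 addr0.
Qed.

(** The conditional probability of a draw given the earlier programs stays valid given the whole
    past: [delta_indep_time] adds the times, then [seq_design] adds the states up to [i]. *)
Lemma draw_orthogonal i f W (q : sample e -> R) : (i < n)%N ->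
  bmeas_on (prog_before e i) q ->
  is_cond_prob P <<s prog_before e i>> (prog e i @^-1` [set f]) (EFin \o q) ->
  bmeas_on (draw_events e i) W ->
  \int[P]_w (W w * ((prog e i w == f)%:R - q w)) = 0.
Proof.
move=> ni bq cq bW.
have n_i := ltnW ni.
have pm := prog_before_measurable hseq n_i.
have tm := time_before_measurable hseq n_i.
have um := state_before_measurable hseq n_i.
have dm := draw_events_measurable hseq n_i.
have mf := seq_prog_measurable _ _ _ hseq i f ni.
have ptm : prog_before e i `|` time_before e i `<=` measurable.
  by move=> A [/pm|/tm].
have pf : prog_at e i (prog e i @^-1` [set f]) by exists [set f] => //; rewrite
    setTI.
have [_ q0] := cond_prob_orthogonal pm mf cq.
have bq' : bmeas_on (prog_before e i `|` time_before e i) q.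
  by apply: bmeas_on_le bq => A pA; apply: sub_gen_smallest; left.
have q1 := cond_indep_orthogonal pm tm mf
  (delta_indep_time _ _ _ _ _ hdelta c i ni) pf bq q0.
have q2 := cond_indep_orthogonal ptm um mf
  (seq_design _ _ _ hseq c i ni) pf bq' q1.
have -> : (fun w => W w * ((prog e i w == f)%:R - q w)) =
    (fun w => W w * (\1_(prog e i @^-1` [set f]) w - q w)).
  apply/funext => w; congr (_ * (_ - _)); rewrite indicE; congr _%:R.
  by apply: congr1; apply/idP/idP; rewrite inE => /eqP.
apply: orthogonal_bmeas bW => //.
apply: (bmeas_integrable (probability_setT P)); apply: bmeasB.
  exact: bmeas_indic.
exact: bmeas_on_meas bq.
Qed.

End delta_designs.

(** * The single-block design *)

Lemma ae_eq0_Ex_sqr (R : realType) (d : measure_display) (T : measurableType d)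
    (P : probability T R) (V : T -> R) :
  bmeas V -> \int[P]_w V w ^+ 2 <= 0 -> ae_eq P setT V (fun=> 0).
Proof.
move=> bV V0.
have bV2 : bmeas (fun w => V w ^+ 2) by under eq_fun do rewrite expr2; exact:
    bmeasM.
have mV2 : measurable_fun setT (EFin \o (fun w => V w ^+ 2)).
  by apply/measurable_EFinP; exact: bV2.1.
have : (\int[P]_w `|(V w ^+ 2)%:E| = 0)%E.
  under eq_integral do rewrite gee0_abs ?lee_fin ?sqr_ge0//.
  rewrite (bmeas_EFin_int (probability_setT P) bV2); congr EFin.
  by apply: le_anti; rewrite V0 Rintegral_ge0// => w _; rewrite sqr_ge0.
move/(ae_eq_integral_abs P measurableT mV2); apply: filterS => w /= h _.
by have [/eqP] := h I; rewrite sqrf_eq0 => /eqP.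
Qed.

Section single_blocks.
Context {R : realType} {F : finType} {dU : measure_display}
  {U : measurableType dU} {C : Type}.
Variables (s : system R F U C) (a : additive_laws R F U C) (M K : R).
Variables (n : nat) (e : experiment R F U C) (c : C) (f g : F).
Hypothesis hblock : single_block s a M n e.
Hypothesis n0 : (0 < n)%N.
Hypothesis Fn : (#|F| %| n)%N.
Hypothesis K1 : 1 <= K.
Hypothesis true_half : forall f,
  (2^-1%:E <= true_law a c f [set x | (`|x| <= K)%R])%E.
Hypothesis fg : f <> g.
Implicit Types (i j k : nat) (W : sample e -> R) (x y : F).

Let P := law e c.
Let P1 : P setT = 1%E := probability_setT P.
Let hdelta := block_delta _ _ _ _ _ hblock.
Let hseq := delta_sequential _ _ _ _ _ hdelta.
Let L := K + 2 * `|M|.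
(** Strict positivity, from [1 <= K], makes the norm bounds of the drift terms positive, as
    [Ex_sqr_minkowski] asks. *)
Let L0 : 0 < L.
Proof. by have := normr_ge0 M; have := K1; rewrite /L; lra. Qed.
Let K0 : 0 <= K. Proof. by rewrite (le_trans _ K1). Qed.
Let m := (n %/ #|F|)%N.

Lemma bmeas_on_prog_draw i W : bmeas_on (prog_before e i) W ->
  bmeas_on (draw_events e i) W.
Proof. by apply: bmeas_on_le => A pA; apply: sub_gen_smallest; left; left. Qed.

Lemma count_beforeE i x w :
  (count_before e i x w)%:R = \sum_(j < i) (prog e j w == x)%:R :> R.
Proof. by rewrite natr_sum. Qed.

Lemma bmeas_on_count i x : bmeas_on (prog_before e i) (fun w => (count_before e
    i x w)%:R : R).
Proof.
under eq_fun do rewrite count_beforeE.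
apply: (@bmeas_sum R _ (g_sigma_algebraType _) _ (fun j w => (prog e j w ==
    x)%:R)) => j ji.
apply: (bmeas_on_fin (fun y => (y == x)%:R)) => A pA; apply: sub_gen_smallest.
exact: events_before_sub pA.
Qed.

Definition remaining i x w : R := m%:R - (count_before e i x w)%:R.

Lemma bmeas_on_remaining i x : bmeas_on (prog_before e i) (remaining i x).
Proof. by apply: bmeasB; [exact: bmeas_cst|exact: bmeas_on_count]. Qed.

Lemma draw_fraction_orthogonal i x W : (i < n)%N -> bmeas_on (draw_events e i)
    W ->
  \int[P]_w (W w * ((prog e i w == x)%:R - remaining i x w / (n - i)%:R)) = 0.
Proof.
move=> ni bW; apply: (draw_orthogonal hdelta (q := fun w => remaining i x w /
    (n - i)%:R)) bW => //.
- by apply: bmeasM; [exact: bmeas_on_remaining|exact: bmeas_cst].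
- exact: (block_draw _ _ _ _ _ hblock).
Qed.

(** This makes the random denominators of the estimator constant. That the block is exhausted is
    read off the last draw alone: one item is left, so the drawing fraction has denominator 1 and is
    the number of missing copies itself. *)
Lemma count_full_ae x : {ae P, forall w, count_before e n x w = m}.
Proof.
have [n' n'E] : exists n', n = n'.+1 by exists n.-1; rewrite prednK.
have n'n : (n' < n)%N by rewrite n'E.
pose Z := remaining n' x; pose I w : R := (prog e n' w == x)%:R.
have gZ : bmeas_on (draw_events e n') Z.
  by apply: bmeas_on_prog_draw; exact: bmeas_on_remaining.
have bZ : bmeas Z := bmeas_on_meas (draw_events_measurable hseq (ltnW n'n)) gZ.
have bI : bmeas I.
  by apply: (bmeas_fin (fun y => (y == x)%:R)) => y; exact:
      (seq_prog_measurable _ _ _ hseq).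
have bZI : bmeas (fun w => Z w - I w) by exact: bmeasB.
have gW : bmeas_on (draw_events e n') (fun w => 1 - 2 * Z w).
  by apply: bmeasB; [exact: bmeas_cst|exact: bmeasZ].
have b1 : bmeas (fun w => Z w * (1 - Z w)).
  by apply: bmeasM => //; apply: bmeasB => //; exact: bmeas_cst.
have b2 : bmeas (fun w => (1 - 2 * Z w) * (I w - Z w)).
  apply: bmeasM; last exact: bmeasB.
  by apply: bmeasB; [exact: bmeas_cst|exact: bmeasZ].
have := draw_fraction_orthogonal x n'n gW.
rewrite (_ : (n - n')%N = 1%N); last by rewrite n'E subSnn.
under eq_Rintegral do rewrite divr1; move=> ortho.
(* The conditional mean of I is Z itself, so E (Z - I)^2 = E (Z (1 - Z)), which
   is nonpositive because Z is an integer. *)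
have Z_le w : Z w * (1 - Z w) <= 0.
  rewrite /Z /remaining; set p := count_before _ _ _ _.
  have [pm|pm] := leqP p m.
    rewrite -natrB//; case: (m - p)%N => [|k]; first by rewrite mul0r.
    by rewrite mulr_ge0_le0// subr_le0 ler1n.
  rewrite mulr_le0_ge0// ?subr_le0 ?ler_nat ?(ltnW pm)//.
  by rewrite subr_ge0 (@le_trans _ _ 0)// subr_le0 ler_nat ltnW.
have ZI0 : \int[P]_w (Z w - I w) ^+ 2 <= 0.
  have -> : \int[P]_w (Z w - I w) ^+ 2 =
      \int[P]_w (Z w * (1 - Z w) + (1 - 2 * Z w) * (I w - Z w)).
    (* The identity relies on I^2 = I, hence the case split. *)
    apply: eq_Rintegral => w _; rewrite /I; move: (Z w) => z.
    by case: (_ == _) => /=; ring.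
  rewrite (ExD P1)// ortho addr0 -(Ex_cst P1 0).
  by apply: (Ex_le P1) => //; exact: bmeas_cst.
apply: filterS (ae_eq0_Ex_sqr bZI ZI0) => w /= /(_ Logic.I) /eqP.
rewrite /Z /I /remaining subr_eq add0r subr_eq -natrD eqr_nat => /eqP ->.
by rewrite n'E /count_before big_ord_recr/= addnC.
Qed.

(** * Imbalance between the two programs *)

Definition contrast x : R := (x == f)%:R - (x == g)%:R.

Definition imbalance i w : R := \sum_(j < i) contrast (prog e j w).

Lemma contrast_sqr_le x : contrast x ^+ 2 <= 1.
Proof. by rewrite /contrast; do 2 case: (_ == _) => /=; lra. Qed.

Lemma imbalanceE i w :
  imbalance i w = (count_before e i f w)%:R - (count_before e i g w)%:R.
Proof. by rewrite !count_beforeE -sumrB. Qed.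

Lemma bmeas_on_imbalance i : bmeas_on (prog_before e i) (imbalance i).
Proof.
rewrite (_ : imbalance i = fun w => (count_before e i f w)%:R - (count_before e
    i g w)%:R).
  by apply: bmeasB; exact: bmeas_on_count.
by apply/funext => w; exact: imbalanceE.
Qed.

(** In the difference of the drawing fractions of [f] and [g] the common quota [m] cancels, leaving
    minus the imbalance over the number of items left. *)
Lemma contrast_orthogonal i W : (i < n)%N -> bmeas_on (draw_events e i) W ->
  \int[P]_w (W w * (contrast (prog e i w) + imbalance i w / (n - i)%:R)) = 0.
Proof.
move=> ni gW.
have dm := draw_events_measurable hseq (ltnW ni).
have bW := bmeas_on_meas dm gW.
have b x : bmeas (fun w => W w * ((prog e i w == x)%:R - remaining i x w / (n -
    i)%:R)).
  apply: bmeasM => //; apply: bmeasB.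
    by apply: (bmeas_fin (fun y => (y == x)%:R)) => y; exact:
        (seq_prog_measurable _ _ _ hseq).
  apply: bmeasM; last exact: bmeas_cst.
  by apply: bmeas_on_meas (bmeas_on_prog_draw (bmeas_on_remaining i x)).
rewrite -[RHS]subr0 -{1}(draw_fraction_orthogonal f ni gW).
rewrite -(draw_fraction_orthogonal g ni gW) -(ExB P1)//.
apply: eq_Rintegral => w _; rewrite imbalanceE /contrast /remaining; ring.
Qed.

Lemma bmeas_contrast i : (i < n)%N -> bmeas (fun w => contrast (prog e i w)).
Proof. by move=> ni; apply: bmeas_fin => y; exact: (seq_prog_measurable _ _ _
    hseq). Qed.

Lemma bmeas_imbalance i : (i <= n)%N -> bmeas (imbalance i).
Proof.
by move=> ni; apply: bmeas_on_meas (bmeas_on_imbalance i); exact: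
    (prog_before_measurable hseq).
Qed.

Lemma Ex_contrast_sqr_le i : (i < n)%N ->
  \int[P]_w contrast (prog e i w) ^+ 2 <= 1.
Proof.
move=> ni; rewrite -[leRHS](Ex_cst P1); apply: (Ex_le P1) => //.
- by apply: bmeas_sqr; exact: bmeas_contrast.
- exact: bmeas_cst.
- by move=> w; exact: contrast_sqr_le.
Qed.

(** The pull back towards balance gives E S_(i+1)^2 = (1 - 2 / (n - i)) E S_i^2 + E h_i^2 with E
    h_i^2 <= 1, and the bound n - i reproduces itself: (n - i) - 2 + 1 = n - (i + 1). *)
Lemma Ex_imbalance_sqr_le i : (i < n)%N ->
  \int[P]_w imbalance i w ^+ 2 <= (n - i)%:R.
Proof.
elim: i => [_|i IH ni].
  under eq_Rintegral do rewrite /imbalance big_ord0 expr0n/=.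
  by rewrite (Ex_cst P1).
have ni' := ltnW ni; have {}IH := IH ni'.
have bS := bmeas_imbalance (ltnW ni').
have bh := bmeas_contrast ni'.
under eq_Rintegral do rewrite /imbalance big_ord_recr/=.
rewrite (Ex_sqrD P bS bh).
have := contrast_orthogonal ni' (bmeas_on_prog_draw (bmeas_on_imbalance i)).
have -> : \int[P]_w (imbalance i w * (contrast (prog e i w) + imbalance i w /
    (n - i)%:R)) =
   \int[P]_w (imbalance i w * contrast (prog e i w)) + (n - i)%:R^-1 *
       \int[P]_w imbalance i w ^+ 2.
  rewrite -(ExZ P1); last exact: bmeas_sqr.
  rewrite -(ExD P1); [|exact: bmeasM|by apply: bmeasZ; exact: bmeas_sqr].
  by apply: eq_Rintegral => w _; ring.
have h1 := Ex_contrast_sqr_le ni'.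
rewrite (_ : (n - i)%:R = (n - i.+1)%:R + 1 :> R) in IH *; last by rewrite
    natr1 subnSK.
(* Here [i.+1 < n], so n - i >= 2 and the factor 1 - 2 / (n - i) is nonnegative; multiplying the
   induction hypothesis by it requires this. *)
have : 1 <= (n - i.+1)%:R :> R by rewrite ler1n subn_gt0.
move: h1 IH; rewrite -/(imbalance i).
move: (\int[P]_w imbalance i w ^+ 2) (\int[P]_w (imbalance i w * _)) (\int[P]_w
    _ ^+ 2).
move=> v z h; set r := (n - i.+1)%:R => h1 vr r1 zv.
have r0 : 0 < r + 1 by lra.
have -> : z = - ((r + 1)^-1 * v) by lra.
have : v * (1 - 2 / (r + 1)) <= (r + 1) * (1 - 2 / (r + 1)).
  by apply: ler_wpM2r => //; rewrite subr_ge0 ler_pdivrMr//; lra.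
rewrite [X in _ <= X -> _](_ : _ = r - 1); last by field; rewrite gt_eqF.
rewrite [X in X <= _ -> _](_ : _ = v + 2 * - ((r + 1)^-1 * v)); last by ring.
by move=> ?; lra.
Qed.

Lemma bmeas_on_imbalance_draw i k : (i <= k)%N ->
  bmeas_on (draw_events e k) (imbalance i).
Proof.
move=> ik; apply: bmeas_on_le (bmeas_on_imbalance i) => A [j /= ji pA].
by apply: (prog_draw _ pA); exact: leq_trans ik.
Qed.

(** * Second moments of the three sums *)

Let mu := true_mean a c L.
Let nu := noise_mean a c L.

Definition noise_term i w := contrast (prog e i w) * run_noise a M K c i w.

Definition draw_term i w :=
  (contrast (prog e i w) + imbalance i w / (n - i)%:R) * nu (state e i w).

Definition drift_term i w := - (imbalance i w / (n - i)%:R * nu (state e i w)).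

Lemma bmeas_noise_term i : (i < n)%N -> bmeas (noise_term i).
Proof.
by move=> ni; apply: bmeasM; [exact: bmeas_contrast|exact: (bmeas_run_noise c
    hdelta)].
Qed.

Lemma bmeas_imbalance_ratio i : (i < n)%N ->
  bmeas (fun w => imbalance i w / (n - i)%:R).
Proof.
by move=> ni; apply: bmeasM; [exact/bmeas_imbalance/ltnW|exact: bmeas_cst].
Qed.

Lemma bmeas_nu_state i : (i < n)%N -> bmeas (fun w => nu (state e i w)).
Proof.
move=> ni; apply: bmeas_comp; first exact: bmeas_noise_mean.
by apply: (seq_state_measurable _ _ _ hseq); exact: ltnW.
Qed.

Lemma bmeas_draw_term i : (i < n)%N -> bmeas (draw_term i).
Proof.
move=> ni; apply: bmeasM; last exact: bmeas_nu_state.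
by apply: bmeasD; [exact: bmeas_contrast|exact: bmeas_imbalance_ratio].
Qed.

Lemma bmeas_drift_term i : (i < n)%N -> bmeas (drift_term i).
Proof.
move=> ni; rewrite /drift_term; under eq_fun do rewrite -mulN1r.
by apply: bmeasZ; apply: bmeasM; [exact: bmeas_imbalance_ratio|exact:
    bmeas_nu_state].
Qed.

(** [prog k] is known when [time k] is measured, so its contrast joins the partial sum in the test
    function. The factor 3 counts the three terms of [run_noise], each at most [L]. *)
Lemma Ex_noise_sqr_le :
  \int[P]_w (\sum_(i < n) noise_term i w) ^+ 2 <= n%:R * (3 * L) ^+ 2.
Proof.
apply: Ex_sqr_orthogonal_sum => k kn; first exact: bmeas_noise_term.
  under eq_Rintegral do rewrite mulrA.
  apply: (run_noise_orthogonal hdelta K0 true_half) => //.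
  apply: bmeasM; last by apply: bmeas_on_fin; exact: prog_run.
  apply: (@bmeas_sum R _ (g_sigma_algebraType _) k noise_term) => i ik.
  apply: bmeasM; last exact: bmeas_on_run_noise.
  by apply: bmeas_on_fin; apply: prog_run; exact: ltnW.
rewrite -[leRHS](Ex_cst P1); apply: (Ex_le P1).
- by apply: bmeas_sqr; exact: bmeas_noise_term.
- exact: bmeas_cst.
- move=> w; rewrite exprMn -[leRHS]mul1r ler_pM ?sqr_ge0 ?contrast_sqr_le//.
  by apply: sqr_norm_le; exact: run_noise_le.
Qed.

Lemma Ex_draw_sqr_le :
  \int[P]_w (\sum_(i < n) draw_term i w) ^+ 2 <= n%:R * L ^+ 2.
Proof.
apply: Ex_sqr_orthogonal_sum => k kn; first exact: bmeas_draw_term.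
  (* The noise mean of [state k] goes into the test function, since that state precedes the draw of
     [prog k]. *)
  rewrite -[RHS](contrast_orthogonal kn
    (W := fun w => (\sum_(i < k) draw_term i w) * nu (state e k w))).
    by apply: eq_Rintegral => w _; rewrite /draw_term; ring.
  have gnu i : (i <= k)%N -> bmeas_on (draw_events e k) (fun w => nu (state e i
      w)).
    by move=> ik; apply: bmeas_on_comp; [exact: state_draw|exact:
        bmeas_noise_mean].
  apply: bmeasM; last exact: gnu.
  apply: (@bmeas_sum R _ (g_sigma_algebraType _) k draw_term) => i ik.
  apply: bmeasM; last exact/gnu/ltnW.
  apply: bmeasD; first by apply: bmeas_on_fin; exact: prog_draw.
  by apply: bmeasM; [exact/bmeas_on_imbalance_draw/ltnW|exact: bmeas_cst].
have bh := bmeas_contrast kn.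
have bs := bmeas_imbalance_ratio kn.
have bhs := bmeasD bh bs.
have bh2 := bmeas_sqr bh.
have bshs := bmeasM bs bhs.
have gs : bmeas_on (draw_events e k) (fun w => imbalance k w / (n - k)%:R).
  by apply: bmeasM; [exact: bmeas_on_imbalance_draw|exact: bmeas_cst].
(* With t the scaled imbalance, (h + t)^2 = h^2 + 2 t (h + t) - t^2; the middle term has mean 0, so
   centring does not raise the second moment. *)
apply: (@le_trans _ _ (\int[P]_w (L ^+ 2 *
    (contrast (prog e k w) ^+ 2 + 2 * (imbalance k w / (n - k)%:R *
      (contrast (prog e k w) + imbalance k w / (n - k)%:R)))))).
  apply: (Ex_le P1).
  - by apply: bmeas_sqr; exact: bmeas_draw_term.
  - by apply: bmeasZ; apply: bmeasD => //; exact: bmeasZ.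
  move=> w; rewrite exprMn mulrC ler_pM ?sqr_ge0//.
    by apply: sqr_norm_le; exact: noise_mean_le.
  set h := contrast _; set t := imbalance _ _ / _.
  by have := sqr_ge0 t; nra.
rewrite (ExZ P1); last by apply: bmeasD => //; exact: bmeasZ.
rewrite (ExD P1)//; last exact: bmeasZ.
rewrite (ExZ P1)// (contrast_orthogonal kn gs) mulr0 addr0.
by rewrite -[leRHS]mulr1 ler_wpM2l ?sqr_ge0// Ex_contrast_sqr_le.
Qed.

(** These terms are functions of the past and need not be orthogonal to one another, so L2 norms are
    added instead of squares. The 4 is the square of the factor 2 in [sum_inv_sqrt_le]. *)
Lemma Ex_drift_sqr_le :
  \int[P]_w (\sum_(i < n) drift_term i w) ^+ 2 <= 4 * n%:R * L ^+ 2.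
Proof.
pose v i : R := L / Num.sqrt (n - i)%:R.
have v0 i : (i < n)%N -> 0 < v i.
  by move=> ni; rewrite divr_gt0// sqrtr_gt0 ltr0n subn_gt0.
apply: (@le_trans _ _ ((\sum_(i < n) v i) ^+ 2)); last first.
  rewrite -mulr_sumr exprMn mulrC ler_wpM2r ?sqr_ge0//.
  apply: (@le_trans _ _ ((2 * Num.sqrt n%:R) ^+ 2)).
    apply: sqr_norm_le; rewrite ger0_norm ?sum_inv_sqrt_le//.
    by apply: sumr_ge0 => i _; rewrite invr_ge0 sqrtr_ge0.
  by rewrite exprMn sqr_sqrtr//; lra.
apply: Ex_sqr_minkowski => // i ni; first exact: bmeas_drift_term.
have r0 : 0 < (n - i)%:R :> R by rewrite ltr0n subn_gt0.
have bS := bmeas_sqr (bmeas_imbalance (ltnW ni)).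
apply: (@le_trans _ _ (\int[P]_w ((L / (n - i)%:R) ^+ 2 * imbalance i w ^+ 2))).
  apply: (Ex_le P1); [|exact: bmeasZ|move=> w].
    by apply: bmeas_sqr; exact: bmeas_drift_term.
  rewrite [leLHS](_ : _ = nu (state e i w) ^+ 2 * (imbalance i w / (n - i)%:R)
      ^+ 2).
    2: by rewrite /drift_term; ring.
  rewrite [leRHS](_ : _ = L ^+ 2 * (imbalance i w / (n - i)%:R) ^+ 2); last by
      ring.
  rewrite ler_wpM2r ?sqr_ge0//.
  by apply: sqr_norm_le; exact: noise_mean_le.
rewrite (ExZ P1)// /v [leRHS]exprMn exprVn sqr_sqrtr; last exact: ltW.
have := Ex_imbalance_sqr_le ni; move: (\int[P]_w _) => I Ir.
rewrite (_ : (_ / _) ^+ 2 * I = L ^+ 2 * ((n - i)%:R^-1 * ((n - i)%:R^-1 *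
    I))); last by ring.
rewrite ler_wpM2l ?sqr_ge0// ler_piMr ?invr_ge0 ?(ltW r0)//.
by rewrite mulrC ler_pdivrMr// mul1r.
Qed.

Lemma measurable_loss_hat x : measurable_fun setT (loss_hat e n x).
Proof.
(* On nonnegative reals, 0 included, the power -1 is the inverse, and power functions are
   measurable. *)
have -> : loss_hat e n x = fun w => powR (count_before e n x w)%:R (-1) *
    \sum_(i < n) (prog e i w == x)%:R * time e i w.
  by apply/funext => w; rewrite powR_inv1.
apply: measurable_funM.
  apply: (measurableT_comp (measurable_powR _)) => //.
  apply: (bmeas_on_meas _ (bmeas_on_count n x)).1.
  exact: (prog_before_measurable hseq).
rewrite -[X in measurable_fun _ X](_ : (fun w => \sum_(i <- enum 'I_n)
    (prog e i w == x)%:R * time e i w) = _); last first.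
  by apply/funext => w; rewrite big_enum.
apply: measurable_sum => i; apply: measurable_funM.
  apply: (bmeas_fin (fun y => (y == x)%:R) _).1 => y.
  exact: (seq_prog_measurable _ _ _ hseq).
exact: (seq_time_measurable _ _ _ hseq).
Qed.

Lemma single_block_variance_le :
  ('V_P[delta_hat e n f g] <= ((42 * L ^+ 2 * #|F|%:R ^+ 2) / n%:R)%:E)%E.
Proof.
have nE : n = (m * #|F|)%N by rewrite /m divnK.
have m0 : (0 < m)%N by move: n0; rewrite {1}nE muln_gt0 => /andP[].
have mR0 : 0 < m%:R :> R by rewrite ltr0n.
have FR0 : 0 < #|F|%:R :> R by rewrite ltr0n; move: n0; rewrite nE muln_gt0 =>
    /andP[].
have bA := bmeas_sum bmeas_noise_term.
have bB := bmeas_sum bmeas_draw_term.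
have bD := bmeas_sum bmeas_drift_term.
pose A w := \sum_(i < n) noise_term i w.
pose B w := \sum_(i < n) draw_term i w.
pose D w := \sum_(i < n) drift_term i w.
pose k := mu f - mu g.
pose X w := m%:R^-1 * (A w + B w + D w) + k.
have bX : bmeas X.
  apply: bmeasD; last exact: bmeas_cst.
  by apply: bmeasZ; apply: bmeasD => //; exact: bmeasD.
have deltaE : ae_eq P setT (delta_hat e n f g) X.
  have tE : {ae P, forall w, forall i, (i < n)%N -> time e i w = clip L (time e
      i w)}.
    apply: ae_foralln => i; have [ni|ni] := ltnP i n.
      by apply: filterS (time_clip_ae c hdelta K0 ni) => w /= /(_ Logic.I).
    (* For [i >= n] the claim is vacuous, and any almost sure event serves. *)
    by apply: filterS (time_clip_ae c hdelta K0 n0) => w.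
  apply: filterS3 tE (count_full_ae f) (count_full_ae g) => w /= tw Nf Ng _.
  rewrite /delta_hat /loss_hat Nf Ng -mulrBr -sumrB.
  have sumE : A w + B w + D w =
      \sum_(i < n) contrast (prog e i w) * time e i w - m%:R * k.
    rewrite /A /B /D -!big_split/=.
    (* Each of [f] and [g] is drawn exactly [m] times, so the mean true run times contribute a
       constant, which becomes the centre [k]. *)
    have -> : m%:R * k = \sum_(i < n) contrast (prog e i w) * mu (prog e i w).
      rewrite (eq_bigr (fun i : 'I_n => (prog e i w == f)%:R * mu f -
          (prog e i w == g)%:R * mu g)).
        by rewrite sumrB -!mulr_suml -!count_beforeE Nf Ng mulrBr.
      move=> i _; rewrite /contrast.
      case: (eqVneq (prog e i w) f) => [->|_].
        by rewrite (introF eqP fg)/=; ring.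
      by case: (eqVneq (prog e i w) g) => [->|_] /=; ring.
    rewrite -sumrB; apply: eq_bigr => i _.
    rewrite /noise_term /draw_term /drift_term /run_noise -/L -/(mu _) -/(nu _).
    by rewrite -tw//; ring.
  rewrite /X sumE mulrBr mulKf ?gt_eqF// subrK; congr (_ * _).
  by apply: eq_bigr => i _; rewrite /contrast mulrBl.
apply: (le_trans (variance_le_sqr (X' := X) k _ bX deltaE)).
  by apply: measurable_funB; exact: measurable_loss_hat.
rewrite lee_fin.
have b3 : bmeas (fun w => 3 * (A w ^+ 2 + B w ^+ 2 + D w ^+ 2)).
  apply: bmeasZ; apply: bmeasD; last exact: bmeas_sqr.
  by apply: bmeasD; exact: bmeas_sqr.
apply: (@le_trans _ _ (\int[P]_w ((m%:R ^+ 2)^-1 * (3 * (A w ^+ 2 + B w ^+ 2 +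
    D w ^+ 2))))).
  apply: (Ex_le P1); [|exact: bmeasZ|move=> w].
    by apply: bmeas_sqr; apply: bmeasB => //; exact: bmeas_cst.
  rewrite /X addrK exprMn exprVn ler_wpM2l ?invr_ge0 ?sqr_ge0//.
  have := sqr_ge0 (A w - B w); have := sqr_ge0 (A w - D w).
  have := sqr_ge0 (B w - D w); lra.
rewrite (ExZ P1)// (ExZ P1); last first.
  by apply: bmeasD; [apply: bmeasD|]; exact: bmeas_sqr.
rewrite (ExD P1); [|by apply: bmeasD; exact: bmeas_sqr|exact: bmeas_sqr].
rewrite (ExD P1); [|exact: bmeas_sqr|exact: bmeas_sqr].
have hA := Ex_noise_sqr_le; have hB := Ex_draw_sqr_le; have hD :=
    Ex_drift_sqr_le.
(* 42 = 3 * (9 + 1 + 4); afterwards n = m |F| turns n / m^2 into |F|^2 / n. *)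
apply: (@le_trans _ _ ((m%:R ^+ 2)^-1 * (42 * (n%:R * L ^+ 2)))).
  rewrite ler_wpM2l ?invr_ge0 ?sqr_ge0//.
  by move: hA hB hD; rewrite -/A -/B -/D exprMn; lra.
rewrite nE natrM le_eqVlt; apply/orP; left; apply/eqP.
by field; rewrite !gt_eqF.
Qed.

End single_blocks.

Unset Implicit Arguments.

Theorem theorem23 (R : realType) (F : finType) (dU : measure_display)
    (U : measurableType dU) (C : Type)
    (s : system R F U C) (a : additive_laws R F U C) (M : R)
    (e : nat -> experiment R F U C)
    (F_ge2 : (2 <= #|F|)%N)
    (e_block : forall n, (0 < n)%N -> (#|F| %| n)%N -> single_block s a M n (e
        n))
    (c : C) (f g : F) (fg : f <> g) :
  exists K : R, \forall n \near \oo, (#|F| %| n)%N ->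
    ('V_(law (e n) c)[delta_hat (e n) n f g] <= (K / n%:R)%:E)%E.
Proof.
have [k k0 kh] : exists2 k : F -> R, (forall x, 0 <= k x) &
    (forall x, 2^-1%:E <= true_law a c x [set t | (`|t| <= k x)%R])%E.
  have := fun x => probability_ball_ge_half (true_law a c x).
  by move=> /(_ _)/cid2 h; exists (fun x => projT1 (h x)) => x; case: (h x).
(* The sum is a common radius for all programs, and the added 1 keeps [L] positive even if [M] is
   0. *)
pose K := 1 + \sum_x k x.
have K1 : 1 <= K by rewrite lerDl sumr_ge0.
have true_half x : (2^-1%:E <= true_law a c x [set t | (`|t| <= K)%R])%E.
  have mball := @measurable_norm_le R.
  apply: le_trans (kh x) _; apply: le_measure; rewrite ?inE//.
  move=> t /= tk; rewrite (le_trans tk)// /K (bigD1 x)//=.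
  by have : 0 <= \sum_(i | i != x) k i by [exact: sumr_ge0]; lra.
exists (42 * (K + 2 * `|M|) ^+ 2 * #|F|%:R ^+ 2).
(* The bound is not asymptotic: the threshold only excludes [n = 0]. *)
exists 1%N => // n /= n0 Fn.
exact: (single_block_variance_le (e_block n n0 Fn) n0 Fn K1 true_half fg).
Qed.
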